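(* For every $\epsilon\in(0,1]$ and every $\alpha\in[1,\frac1\epsilon]$: if there is a polynomial-time $\alpha$-approximation algorithm for $\epsilon$-nice instances of \textsc{Directed Latency with Target}, then there is a polynomial-time $\alpha(1+\epsilon)$-approximation algorithm for \textsc{Directed Latency}.
   Context: An asymmetric metric space $(X,c)$: $c:X\times X\to\mathbb{R}_{\ge0}$, $c(u,u)=0$, triangle inequality, not necessarily symmetric. \textsc{Directed Latency}: given an asymmetric metric space $(V\cup\{s\},c)$, find a path $P$ starting at $s$ visiting each vertex of $V$ exactly once minimizing $\ell(P)=\sum_{v\in V}c_P(v)$, where $c_P(v)$ is the length of the $s$-$v$ subpath of $P$. \textsc{Directed Latency with Target}: given an asymmetric metric space $(V\cup\{s,s'\},c)$, find an $s$-$s'$ path $P$ visiting every vertex of $V$ exactly once minimizing $\ell(P)=\sum_{v\in V}c_P(v)$. For $\epsilon>0$, an instance $(V\cup\{s,s'\},c)$ of \textsc{Directed Latency with Target} is $\epsilon$-nice if $n:=|V|=2^k-1$ for some integer $k$ and each $c(u,v)$ (for distinct $u,v$) is a positive integer bounded by $\frac{2n^5}{\epsilon^2}$.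
   Formalization: The distances c(u,v) are taken to be nonnegative rationals, given in binary as reduced fractions, instead of arbitrary nonnegative reals, since ''polynomial-time'' has no meaning for inputs without a finite encoding. *)

(* Defs.v *)
From HB Require Import structures.
From Stdlib Require Import BinNums.
From mathcomp Require Import all_boot all_order all_algebra.
From mathcomp Require Import reals.

Set Implicit Arguments.
Unset Strict Implicit.
Unset Printing Implicit Defensive.

Import Order.TTheory GRing.Theory Num.Theory.

(** * Polynomial time

    The machine model is the WHILE language over binary trees (N. D. Jones,
    "Computability and Complexity from a Programming Perspective").  Unlike
    the unit-cost version, evaluating an expression here costs the total size
    of all the values it produces, so that a run of cost [t] only ever builds
    data of size at most [t] beyond its input: the model and multitape Turing
    machines simulate each other with polynomial overhead. *)

Inductive tree : Type := TNil | TCons of tree & tree.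

Fixpoint tsize (t : tree) : nat :=
  if t is TCons a b then (tsize a + tsize b).+1 else 1.

Inductive expr : Type :=
  | EVar of nat
  | ENil
  | ECons of expr & expr
  | EHd of expr
  | ETl of expr.

Inductive cmd : Type :=
  | CSkip
  | CAssign of nat & expr
  | CSeq of cmd & cmd
  | CIf of expr & cmd & cmd
  | CWhile of expr & cmd.

Definition store : Type := nat -> tree.

Definition upd (s : store) (x : nat) (v : tree) : store :=
  fun y => if y == x then v else s y.

Fixpoint eval (s : store) (e : expr) : tree :=
  match e with
  | EVar x => s x
  | ENil => TNil
  | ECons a b => TCons (eval s a) (eval s b)
  | EHd a => if eval s a is TCons h _ then h else TNil
  | ETl a => if eval s a is TCons _ t then t else TNil
  end.

Fixpoint ecost (s : store) (e : expr) : nat :=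
  tsize (eval s e) +
  match e with
  | ECons a b => ecost s a + ecost s b
  | EHd a | ETl a => ecost s a
  | _ => 0
  end.

(** [exec c s t s']: started in store [s], the command [c] halts in store [s']
    at total cost [t].  [TNil] is the only false test value. *)
Inductive exec : cmd -> store -> nat -> store -> Prop :=
  | ExecSkip s : exec CSkip s 1 s
  | ExecAssign s x e :
      exec (CAssign x e) s (ecost s e).+1 (upd s x (eval s e))
  | ExecSeq c1 c2 s s1 s2 t1 t2 :
      exec c1 s t1 s1 -> exec c2 s1 t2 s2 ->
      exec (CSeq c1 c2) s (t1 + t2).+1 s2
  | ExecIfTrue e c1 c2 s s' t :
      eval s e <> TNil -> exec c1 s t s' ->
      exec (CIf e c1 c2) s (ecost s e + t).+1 s'
  | ExecIfFalse e c1 c2 s s' t :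
      eval s e = TNil -> exec c2 s t s' ->
      exec (CIf e c1 c2) s (ecost s e + t).+1 s'
  | ExecWhileTrue e c s s1 s2 t1 t2 :
      eval s e <> TNil -> exec c s t1 s1 -> exec (CWhile e c) s1 t2 s2 ->
      exec (CWhile e c) s (ecost s e + t1 + t2).+1 s2
  | ExecWhileFalse e c s :
      eval s e = TNil -> exec (CWhile e c) s (ecost s e).+1 s.

(** Input and output are in variable 0; the other variables start as [TNil]. *)
Definition run (p : cmd) (input : tree) (t : nat) (output : tree) : Prop :=
  exists s' : store, exec p (upd (fun=> TNil) 0 input) t s' /\ s' 0 = output.

(** * Encodings *)

Fixpoint enc_seq (l : seq tree) : tree :=
  if l is x :: l' then TCons x (enc_seq l') else TNil.

Definition enc_bit (b : bool) : tree := if b then TCons TNil TNil else TNil.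

(** Binary, least significant bit first, no leading zeros. *)
Fixpoint bits_of_pos (p : positive) : seq bool :=
  match p with
  | xH => [:: true]
  | xO p' => false :: bits_of_pos p'
  | xI p' => true :: bits_of_pos p'
  end.

Definition bits_of_nat (n : nat) : seq bool :=
  if bin_of_nat n is Npos p then bits_of_pos p else [::].

Definition enc_nat (n : nat) : tree := enc_seq (map enc_bit (bits_of_nat n)).

(** Only used for nonnegative rationals, so no sign is stored. *)
Definition enc_rat (q : rat) : tree :=
  TCons (enc_nat `|numq q|%N) (enc_nat `|denq q|%N).

Definition enc_matrix (N : nat) (c : 'I_N -> 'I_N -> rat) : tree :=
  enc_seq [seq enc_seq [seq enc_rat (c u v) | v <- enum 'I_N] | u <- enum 'I_N].

Definition enc_path (N : nat) (P : seq 'I_N) : tree :=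
  enc_seq [seq enc_nat (val v) | v <- P].

(** * Approximation algorithms for minimization problems *)

Local Open Scope ring_scope.

Record min_problem : Type := MinProblem {
  instance : Type;
  solution : instance -> Type;
  feasible : forall I : instance, solution I -> Prop;
  cost : forall I : instance, solution I -> rat;
  enc_instance : instance -> tree;
  enc_solution : forall I : instance, solution I -> tree }.

(** [valid] is a promise: nothing is required of the algorithm outside it. *)
Definition has_polytime_approx (R : realType) (Pb : min_problem)
    (valid : instance Pb -> Prop) (alpha : R) : Prop :=
  exists (p : cmd) (a d : nat), forall I : instance Pb, valid I ->
    exists (S : solution I) (t : nat),
      [/\ run p (enc_instance I) t (enc_solution S),
          (t <= a * tsize (enc_instance I) ^ d)%N,
          feasible S
        & forall S' : solution I, feasible S' ->
            ratr (cost S) <= alpha * ratr (cost S')].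

(** * Directed latency *)

Definition asym_metric (X : Type) (c : X -> X -> rat) : Prop :=
  [/\ forall u v, 0 <= c u v,
      forall u, c u u = 0
    & forall u v w, c u w <= c u v + c v w].

Section Paths.
Variables (X : finType) (c : X -> X -> rat).

Definition path_length (P : seq X) : rat :=
  \sum_(e <- zip P (behead P)) c e.1 e.2.

(** The length of the subpath of [P] from its first vertex to [v]. *)
Definition dist_along (P : seq X) (v : X) : rat :=
  path_length (take (index v P).+1 P).

Definition latency (V : {set X}) (P : seq X) : rat :=
  \sum_(v in V) dist_along P v.

(** [P] starts at [s] and visits every point exactly once. *)
Definition spanning_path_from (s : X) (P : seq X) : Prop :=
  [/\ ohead P = Some s, uniq P & forall v : X, v \in P].

End Paths.

(** The points of [V + {s}] are ['I_n.+1] with [n = #|V|] and [s = 0]. *)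
Record dl_instance : Type := DLInstance {
  dl_n : nat;
  dl_c : 'I_dl_n.+1 -> 'I_dl_n.+1 -> rat;
  dl_metric : asym_metric dl_c }.

Definition dl_V (I : dl_instance) : {set 'I_(dl_n I).+1} := [set~ ord0].

Definition directed_latency : min_problem := {|
  instance := dl_instance;
  solution := fun I => seq 'I_(dl_n I).+1;
  feasible := fun I P => spanning_path_from ord0 P;
  cost := fun I P => latency (@dl_c I) (dl_V I) P;
  enc_instance := fun I => enc_matrix (@dl_c I);
  enc_solution := fun I P => enc_path P |}.

(** The points of [V + {s, s'}] are ['I_n.+2] with [n = #|V|], [s = 0] and
    [s' = n.+1]. *)
Record dlt_instance : Type := DLTInstance {
  dlt_n : nat;
  dlt_c : 'I_dlt_n.+2 -> 'I_dlt_n.+2 -> rat;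
  dlt_metric : asym_metric dlt_c }.

Definition dlt_V (I : dlt_instance) : {set 'I_(dlt_n I).+2} :=
  ~: [set ord0; ord_max].

Definition directed_latency_target : min_problem := {|
  instance := dlt_instance;
  solution := fun I => seq 'I_(dlt_n I).+2;
  feasible := fun I P => spanning_path_from ord0 P /\ last ord0 P = ord_max;
  cost := fun I P => latency (@dlt_c I) (dlt_V I) P;
  enc_instance := fun I => enc_matrix (@dlt_c I);
  enc_solution := fun I P => enc_path P |}.

Definition nice (R : realType) (eps : R) (I : dlt_instance) : Prop :=
  (exists k : nat, dlt_n I = (2 ^ k - 1)%N) /\
  forall u v : 'I_(dlt_n I).+2, u != v ->
    [/\ dlt_c u v \is a Num.int,
        0 < dlt_c u v
      & ratr (dlt_c u v) <= 2 * (dlt_n I)%:R ^+ 5 / eps ^+ 2].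

(* Main.v *)
Require Import Defs.
From Stdlib Require Import BinNums BinPos.
From mathcomp Require Import all_boot all_order all_algebra.
From mathcomp Require Import zify ring lra.
From mathcomp Require Import boolp reals.

(** Let [c] be the given metric on [s] and [n] vertices.  Fix an integer [E]
    with [1/eps <= E <= 2/eps], let [N = 2^k - 1] exceed [n + 9], and set
    [K = 2 N^2 E] and [L = 4 N^4 E^2].  For a guess [D] of the longest edge of
    an optimal path, round [c] to [1 + min (ceil (K c / D), L)], which is
    again a metric, and add copies of [s] to get [N] vertices and the target
    [s'].  The copies of [s] can be visited first at small cost, and the edge
    into [s'] is not paid for, so a copy of [s] may serve as target.

    The algorithm runs the given approximation on the rounded instance for
    every entry [D] of the distance matrix, drops the copies of [s] from the
    path [P_D] it obtains, and outputs [P_D] for the smallest [D] such that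
    [K c <= L D] on all edges of [P_D].  For any path [Q] with longest edge
    [D_Q] the rounded optimum is at most [2 N^2 K], so no edge of [P_(D_Q)]
    hits the cap and the chosen [D] satisfies [D <= D_Q <= cost Q].  Hence
    [K cost(P_D) <= alpha (K cost(Q) + 2 N^2 D) <= alpha K (1 + eps) cost(Q)].
*)

Set Implicit Arguments.
Unset Strict Implicit.
Unset Printing Implicit Defensive.

Import Order.TTheory GRing.Theory Num.Theory.

(* [tuple] also has a [tsize]. *)
Local Notation tsize := Defs.tsize.

(** * Polynomially bounded functions *)

(** Polynomial time refers to a concrete machine, so the algorithm has to become a WHILE program,
    and much of the work is to close the polynomial-time functions under the constructions used.
    This shapes the algorithm. [E] replaces the real [1/eps] because a program can only hold a fixed
    integer. [K] and [L] are polynomial in [N], so rounding may count in unary up to the cap and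
    needs no division. Picking the smallest passing [D] instead of the cheapest path means that
    rationals are only compared, by cross-multiplication, and never added. The constants: if all
    edges are at most [D], rounded edges are at most [K + 1 <= 2K], which bounds the rounded latency
    by [2 N^2 K]; the approximate path may lose a further factor [alpha <= 1/eps <= E], whence
    [L = 2 N^2 K E]. The ceiling and the added 1 cost at most [2D] per edge after scaling by [D], so
    [2 N^2 D] in total, and [K eps >= 2 N^2] absorbs this. The lower bound on [N] leaves room
    between [L + 1] and the bound [2 N^5 / eps^2] of nice instances. *)

Definition polyb (q : nat -> nat) : Prop :=
  {homo q : m n / m <= n} /\ exists a d, forall n, q n <= a * n.+1 ^ d.

Lemma polyb_const c : polyb (fun=> c).
Proof. by split=> //; exists c, 0 => n; rewrite expn0 muln1. Qed.

Lemma polyb_id : polyb id.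
Proof. by split=> //; exists 1, 1 => n; rewrite expn1 mul1n. Qed.

Lemma polybD q r : polyb q -> polyb r -> polyb (fun n => q n + r n).
Proof.
move=> [mq [a [d qle]]] [mr [b [e rle]]]; split.
  by move=> m n lemn; rewrite leq_add ?mq ?mr.
exists (a + b), (d + e) => n; rewrite mulnDl leq_add //.
  by apply: leq_trans (qle n) _; rewrite leq_mul2l leq_pexp2l ?orbT ?leq_addr.
by apply: leq_trans (rle n) _; rewrite leq_mul2l leq_pexp2l ?orbT ?leq_addl.
Qed.

Lemma polybM q r : polyb q -> polyb r -> polyb (fun n => q n * r n).
Proof.
move=> [mq [a [d qle]]] [mr [b [e rle]]]; split.
  by move=> m n lemn; rewrite leq_mul ?mq ?mr.
exists (a * b), (d + e) => n.
by apply: leq_trans (leq_mul (qle n) (rle n)) _; rewrite expnD mulnACA.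
Qed.

Lemma leq_expr2 m n d : m <= n -> m ^ d <= n ^ d.
Proof. by case: d => // d le_mn; rewrite leq_exp2r. Qed.

Lemma polyb_comp q r : polyb q -> polyb r -> polyb (fun n => q (r n)).
Proof.
move=> [mq [a [d qle]]] [mr [b [e rle]]]; split.
  by move=> m n lemn; apply/mq/mr.
exists (a * b.+1 ^ d), (e * d) => n; apply: leq_trans (qle _) _.
rewrite -mulnA leq_mul2l expnM -expnMn; apply/orP; right.
by apply: leq_expr2; rewrite mulSn -add1n leq_add ?expn_gt0.
Qed.

Ltac poly :=
  repeat first [ assumption | apply: polyb_const | apply: polyb_id
               | apply: polybD | apply: polybM
               | match goal with H : polyb ?q |- polyb (fun n => ?q _) =>
                   apply: (polyb_comp H) end ].

(** * Programs and their footprint *)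

Lemma tsize_gt0 t : 0 < tsize t.
Proof. by case: t. Qed.

Lemma ecost_eval s e : tsize (eval s e) <= ecost s e.
Proof. by case: e => *; rewrite leq_addr. Qed.

(* The cost of an assignment covers the size of the value it stores. *)
Lemma exec_size p s t s' :
  exec p s t s' -> forall i, tsize (s' i) <= tsize (s i) + t.
Proof.
elim=> {p s t s'} [s|s x e|c1 c2 s s1 s2 t1 t2 _ IH1 _ IH2|e c1 c2 s s' t _ _ IH
  |e c1 c2 s s' t _ _ IH|e c s s1 s2 t1 t2 _ _ IH1 _ IH2|e c s _] i;
  rewrite ?leq_addr //.
- rewrite /upd; case: eqP => _; last by rewrite leq_addr.
  by have := ecost_eval s e; lia.
- by have := IH1 i; have := IH2 i; lia.
- by have := IH i; lia.
- by have := IH i; lia.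
- by have := IH1 i; have := IH2 i; lia.
Qed.

Fixpoint ebound (e : expr) : nat :=
  match e with
  | EVar x => x.+1
  | ENil => 0
  | ECons a b => maxn (ebound a) (ebound b)
  | EHd a | ETl a => ebound a
  end.

Fixpoint cbound (c : cmd) : nat :=
  match c with
  | CSkip => 0
  | CAssign x e => maxn x.+1 (ebound e)
  | CSeq c1 c2 => maxn (cbound c1) (cbound c2)
  | CIf e c1 c2 => maxn (ebound e) (maxn (cbound c1) (cbound c2))
  | CWhile e c => maxn (ebound e) (cbound c)
  end.

Definition agree (m : nat) (s s' : store) : Prop := forall i, i < m -> s i = s' i.

Lemma eval_agree m s s' e : agree m s s' -> ebound e <= m ->
  eval s e = eval s' e /\ ecost s e = ecost s' e.
Proof.
move=> ag; elim: e => [x|//|a IHa b IHb|a IHa|a IHa] /=.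
- by move=> lt_xm; rewrite (ag _ lt_xm).
- by rewrite geq_max => /andP[/IHa[-> ->] /IHb[-> ->]].
- by move=> /IHa[-> ->].
- by move=> /IHa[-> ->].
Qed.

(** A program sees only the variables below [cbound]. Hence a program specified by [run], whose
    other variables start as [TNil], can serve as a subroutine in a store that holds parked data. *)
Lemma exec_frame m p s t s' : exec p s t s' -> cbound p <= m ->
  forall s2, agree m s s2 -> exists s2',
    [/\ exec p s2 t s2', agree m s' s2' & forall i, m <= i -> s2' i = s2 i].
Proof.
elim=> {p s t s'} [s|s x e|c1 c2 s s1 s2 t1 t2 _ IH1 _ IH2
  |e c1 c2 s s' t nz _ IH|e c1 c2 s s' t z _ IH
  |e c s s1 s2 t1 t2 nz _ IH1 _ IH2|e c s z] /=; rewrite ?geq_max.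
- by move=> _ s2 ag; exists s2; split=> //; constructor.
- move=> /andP[lt_xm le_em] s2 ag; have [-> ->] := eval_agree ag le_em.
  exists (upd s2 x (eval s2 e)); split; first exact: ExecAssign.
    by move=> i lt_im; rewrite /upd; case: eqP => // _; apply: ag.
  by move=> i le_mi; rewrite /upd; case: eqP => // eix; lia.
- move=> /andP[le1 le2] s3 ag; have [s4 [ex4 ag4 fr4]] := IH1 le1 _ ag.
  have [s5 [ex5 ag5 fr5]] := IH2 le2 _ ag4; exists s5; split=> //.
    exact: ExecSeq ex4 ex5.
  by move=> i le_mi; rewrite fr5 // fr4.
- move=> /and3P[lee le1 le2] s3 ag; have [ev ec] := eval_agree ag lee.
  have [s4 [ex4 ag4 fr4]] := IH le1 _ ag; exists s4; split=> //.
  by rewrite ec; apply: ExecIfTrue => //; rewrite -ev.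
- move=> /and3P[lee le1 le2] s3 ag; have [ev ec] := eval_agree ag lee.
  have [s4 [ex4 ag4 fr4]] := IH le2 _ ag; exists s4; split=> //.
  by rewrite ec; apply: ExecIfFalse => //; rewrite -ev.
- move=> /andP[lee lec] s3 ag; have [ev ec] := eval_agree ag lee.
  have [s4 [ex4 ag4 fr4]] := IH1 lec _ ag.
  have /IH2 : maxn (ebound e) (cbound c) <= m by rewrite geq_max lee.
  case/(_ _ ag4) => s5 [ex5 ag5 fr5]; exists s5; split=> //.
    by rewrite ec; apply: ExecWhileTrue ex4 ex5; rewrite -ev.
  by move=> i le_mi; rewrite fr5 // fr4.
- move=> /andP[lee lec] s3 ag; have [ev ec] := eval_agree ag lee.
  exists s3; split=> //; rewrite ec; apply: ExecWhileFalse; by rewrite -ev.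
Qed.

Fixpoint clear_vars (m : nat) : cmd :=
  if m is m'.+1 then CSeq (clear_vars m') (CAssign m ENil) else CSkip.

Lemma exec_clear m s : exists s', [/\ exec (clear_vars m) s (3 * m).+1 s',
  s' 0 = s 0, forall i, 0 < i <= m -> s' i = TNil & forall i, m < i -> s' i = s i].
Proof.
elim: m => [|m [s' [ex s0 z fr]]] /=.
  by exists s; split=> //; [apply: ExecSkip | case].
exists (upd s' m.+1 TNil); split=> //.
- have -> : (3 * m.+1).+1 = ((3 * m).+1 + 2).+1 by lia.
  exact: ExecSeq ex (ExecAssign _ _ _).
- move=> i /andP[i_gt0 le_im]; rewrite /upd; case: eqP => // ne.
  by apply: z; lia.
- move=> i lt_mi; rewrite /upd; case: eqP => ne; first by lia.
  by apply: fr; lia.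
Qed.

(** * Polynomial-time functions between encoded types *)

(* The store is arbitrary outside variable 0 and is preserved from [m] on, so
   that such programs can be chained with data parked in fresh variables. *)
Definition computes (A B : Type) (eA : A -> tree) (eB : B -> tree) (f : A -> B)
    (p : cmd) (m : nat) (q : nat -> nat) : Prop :=
  forall x s, s 0 = eA x -> exists t s',
    [/\ exec p s t s', s' 0 = eB (f x), forall i, m <= i -> s' i = s i
      & t <= q (tsize (eA x))].

(** [0 < m] keeps the parking variables [m], [m.+1], ... apart from variable 0, which carries input
    and output. *)
Definition ptime (A B : Type) (eA : A -> tree) (eB : B -> tree) (f : A -> B) :=
  exists p m q, [/\ 0 < m, polyb q & computes eA eB f p m q].

Lemma computes_widen A B eA eB (f : A -> B) p m m' q :
  m <= m' -> computes eA eB f p m q -> computes eA eB f p m' q.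
Proof.
move=> le_mm' H x s s0; have [t [s' [? ? fr ?]]] := H x s s0.
by exists t, s'; split=> // i le; apply: fr; apply: leq_trans le.
Qed.

(** The entry point for the assumed approximation algorithm: its variables are cleared first, then
    [exec_frame] transfers its run to the actual store. *)
Lemma ptime_of_run A B (eA : A -> tree) (eB : B -> tree) (f : A -> B) p a d :
  (forall x, exists2 t, run p (eA x) t (eB (f x)) & t <= a * tsize (eA x) ^ d) ->
  ptime eA eB f.
Proof.
move=> H; pose m := (cbound p).+1.
exists (CSeq (clear_vars m) p), m.+1, (fun n => (3 * m).+2 + a * n.+1 ^ d).
split=> //.
  split=> [n n' le|]; first by rewrite leq_add2l leq_mul2l leq_expr2 ?orbT.
  exists ((3 * m).+2 + a), d => n; rewrite mulnDl leq_add2r leq_pmulr //.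
  by rewrite expn_gt0.
move=> x s s0; have [s1 [ex1 s10 z1 fr1]] := exec_clear m s.
have [t [s' [ex out]] le_t] := H x.
have ag : agree m (upd (fun=> TNil) 0 (eA x)) s1.
  move=> i lt_im; rewrite /upd; case: eqP => [->|/eqP ne]; first by rewrite s10.
  by rewrite z1 // lt0n ne ltnW.
have [s2 [ex2 ag2 fr2]] := exec_frame ex (leqnSn _) ag.
exists ((3 * m).+1 + t).+1, s2; split.
- exact: ExecSeq ex1 ex2.
- by rewrite -ag2.
- by move=> i le; rewrite fr2 ?fr1 //; lia.
- rewrite -addSn leq_add2l; apply: leq_trans le_t _.
  by rewrite leq_mul2l leq_expr2 ?orbT.
Qed.

Lemma run_of_ptime A B (eA : A -> tree) (eB : B -> tree) (f : A -> B) :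
  ptime eA eB f -> exists p a d, forall x,
    exists2 t, run p (eA x) t (eB (f x)) & t <= a * tsize (eA x) ^ d.
Proof.
move=> [p [m [q [_ [_ [a [d le_q]]] H]]]]; exists p, (a * 2 ^ d), d => x.
have [t [s' [ex out _ le_t]]] := H x (upd (fun=> TNil) 0 (eA x)) erefl.
exists t; first by exists s'.
apply: leq_trans le_t _; apply: leq_trans (le_q _) _.
rewrite -mulnA leq_mul2l -expnMn leq_expr2 ?orbT //.
by have := tsize_gt0 (eA x); lia.
Qed.

(** Only the encodings matter, so the type of the result may change: a nonempty list is read as a
    pair, a number as its list of bits, a matrix as a list of lists. *)
Lemma ptime_ext A B C eA (eB : B -> tree) (eC : C -> tree) (f : A -> B)
    (g : A -> C) :
  (forall x, eB (f x) = eC (g x)) -> ptime eA eB f -> ptime eA eC g.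
Proof.
move=> efg [p [m [q [m0 pq H]]]]; exists p, m, q; split=> // x s s0.
by have [t [s' [? out ? ?]]] := H x s s0; exists t, s'; split; rewrite -?efg.
Qed.

Lemma ptime_size A B eA eB (f : A -> B) : ptime eA eB f ->
  exists2 q, polyb q & forall x, tsize (eB (f x)) <= q (tsize (eA x)).
Proof.
move=> [p [m [q [m0 pq H]]]]; exists (fun n => n + q n); first by poly.
move=> x; have [t [s' [ex <- _ le_t]]] := H x (fun=> eA x) erefl.
by have := exec_size ex 0; lia.
Qed.

Lemma ptime_comp A B C eA eB eC (g : B -> C) (f : A -> B) :
  ptime eB eC g -> ptime eA eB f -> ptime eA eC (fun x => g (f x)).
Proof.
move=> [pg [mg [qg [g0 pqg Hg]]]] Pf; have [r pr le_r] := ptime_size Pf.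
case: Pf => [pf [mf [qf [f0 pqf Hf]]]].
exists (CSeq pf pg), (maxn mf mg), (fun n => (qf n + qg (r n)) + 1).
split; [by lia | by poly | move=> x s s0].
have [t1 [s1 [ex1 out1 fr1 le1]]] := Hf x s s0.
have [t2 [s2 [ex2 out2 fr2 le2]]] := Hg _ s1 out1.
exists (t1 + t2).+1, s2; split=> //; first exact: ExecSeq ex1 ex2.
  by move=> i le; rewrite fr2 ?fr1 //; lia.
have : qg (tsize (eB (f x))) <= qg (r (tsize (eA x))) by case: pqg => -> .
by lia.
Qed.

(** * Expressions, pairs and branching *)

Fixpoint only0 (e : expr) : bool :=
  match e with
  | EVar x => x == 0
  | ENil => true
  | ECons a b => only0 a && only0 b
  | EHd a | ETl a => only0 a
  end.

Lemma ecost_only0 e : only0 e ->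
  exists C, forall s, ecost s e <= C * tsize (s 0).
Proof.
elim: e => [x|_|a IHa b IHb|a IHa|a IHa] /=.
- by move/eqP->; exists 1 => s; lia.
- by exists 1 => s; have := tsize_gt0 (s 0); lia.
- case/andP=> /IHa[C HC] /IHb[D HD]; exists (C + C + D + D + 1) => s.
  have := HC s; have := HD s; have := ecost_eval s a; have := ecost_eval s b.
  by have := tsize_gt0 (s 0); lia.
- case/IHa=> C HC; exists (C + C + 1) => s.
  have := HC s; have := ecost_eval s a; have := tsize_gt0 (s 0).
  by case: (eval s a) => /=; lia.
- case/IHa=> C HC; exists (C + C + 1) => s.
  have := HC s; have := ecost_eval s a; have := tsize_gt0 (s 0).
  by case: (eval s a) => /=; lia.
Qed.

Lemma ptime_expr A B (eA : A -> tree) (eB : B -> tree) (f : A -> B) e :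
  only0 e -> (forall x s, s 0 = eA x -> eval s e = eB (f x)) -> ptime eA eB f.
Proof.
move=> /ecost_only0[C HC] He.
exists (CAssign 0 e), 1, (fun n => C * n + 1); split=> //; first by poly.
move=> x s s0; exists (ecost s e).+1, (upd s 0 (eval s e)); split=> //.
- exact: ExecAssign.
- by rewrite /upd /= (He x).
- by case.
- by rewrite -s0 addn1 ltnS.
Qed.

Fixpoint const_expr (t : tree) : expr :=
  if t is TCons a b then ECons (const_expr a) (const_expr b) else ENil.

Lemma eval_const s t : eval s (const_expr t) = t.
Proof. by elim: t => //= a -> b ->. Qed.

Lemma only0_const t : only0 (const_expr t).
Proof. by elim: t => //= a -> b ->. Qed.

Lemma ptime_const A B (eA : A -> tree) (eB : B -> tree) (y : B) :
  ptime eA eB (fun=> y).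
Proof.
by apply: (ptime_expr (only0_const (eB y))) => x s _; rewrite eval_const.
Qed.

Lemma ptime_id A (eA : A -> tree) : ptime eA eA (fun x => x).
Proof. exact: (@ptime_expr _ _ _ _ _ (EVar 0)). Qed.

Definition enc_pair (A B : Type) (eA : A -> tree) (eB : B -> tree) (p : A * B) :=
  TCons (eA p.1) (eB p.2).

Lemma ptime_fst A B C eA eB (eC : C -> tree) (f : C -> A * B) :
  ptime eC (enc_pair eA eB) f -> ptime eC eA (fun x => (f x).1).
Proof.
apply: (ptime_comp (g := fst)).
by apply: (@ptime_expr _ _ _ _ _ (EHd (EVar 0))) => //= x s ->.
Qed.

Lemma ptime_snd A B C eA eB (eC : C -> tree) (f : C -> A * B) :
  ptime eC (enc_pair eA eB) f -> ptime eC eB (fun x => (f x).2).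
Proof.
apply: (ptime_comp (g := snd)).
by apply: (@ptime_expr _ _ _ _ _ (ETl (EVar 0))) => //= x s ->.
Qed.

Lemma ptime_pair A B C eA eB (eC : C -> tree) (f : C -> A) (g : C -> B) :
  ptime eC eA f -> ptime eC eB g -> ptime eC (enc_pair eA eB) (fun x => (f x, g x)).
Proof.
move=> Pf Pg; have [rf prf le_rf] := ptime_size Pf.
have [rg prg le_rg] := ptime_size Pg.
case: Pf Pg => [pf [mf [qf [f0 pqf Hf]]]] [pg [mg [qg [g0 pqg Hg]]]].
pose m := maxn mf mg.
have {}Hf := computes_widen (leq_maxl mf mg : mf <= m) Hf.
have {}Hg := computes_widen (leq_maxr mf mg : mg <= m) Hg.
have m0 : 0 < m by rewrite /m; lia.
move: m {f0 g0} => m in Hf Hg m0 *.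
(* The input is parked in variable [m] while [pf] runs, and the result of [pf] in [m.+1] while [pg]
   runs. *)
exists (CSeq (CAssign m (EVar 0)) (CSeq pf (CSeq (CAssign m.+1 (EVar 0))
  (CSeq (CAssign 0 (EVar m)) (CSeq pg
    (CAssign 0 (ECons (EVar m.+1) (EVar 0)))))))), m.+2,
  (fun n => n + qf n + rf n + n + qg n + (rf n + rg n + rf n + rg n) + 20).
split=> //; first by poly.
move=> x s s0; set n := tsize (eC x).
have [t1 [s1 [ex1 out1 fr1 le1]]] := Hf x (upd s m (s 0)) ltac:(
  by rewrite /upd; case: eqP => // e; lia).
pose s2 := upd (upd s1 m.+1 (s1 0)) 0 (s1 m).
have s1m : s1 m = eC x by rewrite fr1 // /upd eqxx.
have [t3 [s3 [ex3 out3 fr3 le3]]] := Hg x s2 ltac:(by rewrite /s2 /upd eqxx).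
have s3m : s3 m.+1 = eA (f x) by rewrite fr3 // /s2 /upd eqxx /= out1.
have Em : upd s1 m.+1 (s1 0) m = s1 m.
  by rewrite /upd; case: eqP => // e; lia.
have E2 : exec (CAssign 0 (EVar m)) (upd s1 m.+1 (s1 0))
    (ecost (upd s1 m.+1 (s1 0)) (EVar m)).+1 s2.
  have -> : s2 = upd (upd s1 m.+1 (s1 0)) 0
                   (eval (upd s1 m.+1 (s1 0)) (EVar m)).
    by rewrite /= Em.
  exact: ExecAssign.
exists ((ecost s (EVar 0)).+1 + (t1 + ((ecost s1 (EVar 0)).+1 +
  ((ecost (upd s1 m.+1 (s1 0)) (EVar m)).+1 + (t3 +
    (ecost s3 (ECons (EVar m.+1) (EVar 0))).+1).+1).+1).+1).+1).+1.
exists (upd s3 0 (TCons (s3 m.+1) (s3 0))); split=> //.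
- apply: ExecSeq; first exact: ExecAssign.
  apply: ExecSeq; first exact: ex1.
  apply: ExecSeq; first exact: ExecAssign.
  apply: ExecSeq.
    exact: E2.
  apply: ExecSeq; first exact: ex3.
  exact: ExecAssign.
- by rewrite {1}/upd /= s3m out3.
- move=> i le; have [i0 im im1] : [/\ i <> 0, i <> m & i <> m.+1] by split; lia.
  rewrite /upd; case: eqP => // _; rewrite fr3 ?(ltnW (ltnW le)) //.
  rewrite /s2 /upd; do 2![case: eqP => // _]; rewrite fr1; last by lia.
  by rewrite /upd; case: eqP.
- rewrite /= !addn0 Em s0 out1 s1m s3m out3 -/n.
  have := le_rf x; have := le_rg x; rewrite -/n in le1 le3 *; lia.
Qed.

Lemma ptime_if A B eA eB (b : A -> bool) (f g : A -> B) :
  ptime eA enc_bit b -> ptime eA eB f -> ptime eA eB g ->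
  ptime eA eB (fun x => if b x then f x else g x).
Proof.
move=> Pb [pf [mf [qf [f0 pqf Hf]]]] [pg [mg [qg [g0 pqg Hg]]]].
have [pc [mc [qc [c0 pqc Hc]]]] := ptime_pair Pb (ptime_id eA).
pose m := maxn mc (maxn mf mg).
have {}Hc := computes_widen (leq_maxl _ _ : mc <= m) Hc.
have {}Hf := computes_widen (ltac:(rewrite /m; lia) : mf <= m) Hf.
have {}Hg := computes_widen (ltac:(rewrite /m; lia) : mg <= m) Hg.
have m0 : 0 < m by rewrite /m; lia.
move: m {f0 g0} => m in Hc Hf Hg m0 *.
exists (CSeq pc (CSeq (CAssign m (EHd (EVar 0))) (CSeq (CAssign 0 (ETl (EVar 0)))
   (CIf (EVar m) pf pg)))), m.+1, (fun n => qc n + (4 * n + qf n + qg n + 40)).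
split=> //; first by poly.
move=> x s s0; set n := tsize (eA x).
have [t1 [s1 [ex1 out1 fr1 le1]]] := Hc x s s0.
pose s2 := upd s1 m (enc_bit (b x)); pose s3 := upd s2 0 (eA x).
have s30 : s3 0 = eA x by [].
have s3m : s3 m = enc_bit (b x).
  by rewrite /s3 /upd; case: eqP => e; [lia | rewrite /s2 /upd eqxx].
have s20 : s2 0 = TCons (enc_bit (b x)) (eA x).
  by rewrite /s2 /upd; case: eqP => e; [lia | rewrite out1].
have [t4 [s4 [ex4 out4 fr4 le4]]] : exists t s',
    [/\ exec (CIf (EVar m) pf pg) s3 t s',
        s' 0 = eB (if b x then f x else g x), forall i, m <= i -> s' i = s3 i
      & t <= 4 + qf n + qg n].
  case E : (b x) s3m => s3m.
    have [t [s' [ex ? ? le]]] := Hf x s3 s30.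
    exists (ecost s3 (EVar m) + t).+1, s'; split=> //.
      by apply: ExecIfTrue ex; rewrite /= s3m.
    by rewrite /= s3m /= addn0; rewrite -/n in le; lia.
  have [t [s' [ex ? ? le]]] := Hg x s3 s30.
  exists (ecost s3 (EVar m) + t).+1, s'; split=> //.
    by apply: ExecIfFalse ex; rewrite /= s3m.
  by rewrite /= s3m /= addn0; rewrite -/n in le; lia.
have E2 : eval s1 (EHd (EVar 0)) = enc_bit (b x) by rewrite /= out1.
have E3 : eval s2 (ETl (EVar 0)) = eA x by rewrite /= s20.
exists (t1 + ((ecost s1 (EHd (EVar 0))).+1 + ((ecost s2 (ETl (EVar 0))).+1 +
  t4).+1).+1).+1, s4; split=> //.
- apply: ExecSeq; first exact: ex1.
  apply: ExecSeq; first exact: ExecAssign.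
  rewrite E2 -/s2; apply: ExecSeq; first exact: ExecAssign.
  by rewrite E3.
- move=> i le; rewrite fr4 ?(ltnW le) // /s3 /s2 /upd.
  by do 2![case: eqP => [?|_]; first by lia]; rewrite fr1 // ltnW.
- have eb : tsize (enc_bit (b x)) <= 3 by case: (b x).
  rewrite /= out1 s20 /= in E2 E3 *; rewrite -/n in le1 le4 *.
  by lia.
Qed.

(** * Lists and bounded loops *)

Definition enc_list (A : Type) (eA : A -> tree) (l : seq A) := enc_seq (map eA l).

Lemma tsize_enc_list A (eA : A -> tree) l k :
  tsize (enc_list eA (drop k l)) <= tsize (enc_list eA l).
Proof.
elim: l k => [|a l IH] [|k] //=; apply: leq_trans (IH k) _.
by rewrite /enc_list /=; lia.
Qed.

Lemma size_enc_list A (eA : A -> tree) l : size l < tsize (enc_list eA l).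
Proof. by elim: l => //= a l; rewrite /enc_list /=; lia. Qed.

(** The basic loop. A step that is polynomial in the current state could still double the state each
    time, so a polynomial bound on all intermediate states is assumed. Variables [m], [m.+1] and
    [m.+2] hold the input, the state and the rest of the list. *)
Lemma ptime_foldl X S B eX eS eB (l : X -> seq B) (init : X -> S)
    (step : X -> S -> B -> S) q :
  polyb q ->
  ptime eX (enc_list eB) l -> ptime eX eS init ->
  ptime (enc_pair eX (enc_pair eS eB)) eS (fun p => step p.1 p.2.1 p.2.2) ->
  (forall x k, tsize (eS (foldl (step x) (init x) (take k (l x))))
     <= q (tsize (eX x))) ->
  ptime eX eS (fun x => foldl (step x) (init x) (l x)).
Proof.
move=> pq Pl Pi [pc [mc [qc [c0 pqc Hc]]]] le_q.
have [r pr le_r] := ptime_size Pl.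
have [pi [mi [qi [i0 pqi Hi]]]] := ptime_pair (ptime_id eX) (ptime_pair Pi Pl).
pose m := maxn mc mi.
have {}Hc := computes_widen (leq_maxl _ _ : mc <= m) Hc.
have {}Hi := computes_widen (leq_maxr _ _ : mi <= m) Hi.
have m0 : 0 < m by rewrite /m; lia.
move: m {i0 c0} => m in Hc Hi m0 *.
pose body := CSeq (CAssign 0 (ECons (EVar m) (ECons (EVar m.+1) (EHd (EVar m.+2)))))
  (CSeq pc (CSeq (CAssign m.+1 (EVar 0)) (CAssign m.+2 (ETl (EVar m.+2))))).
exists (CSeq pi (CSeq (CAssign m (EHd (EVar 0)))
  (CSeq (CAssign m.+1 (EHd (ETl (EVar 0))))
  (CSeq (CAssign m.+2 (ETl (ETl (EVar 0))))
  (CSeq (CWhile (EVar m.+2) body) (CAssign 0 (EVar m.+1))))))), m.+3.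
(* [W n] bounds one iteration with its loop test; the argument of [qc] bounds the encoded triple of
   input, state and element. *)
pose W n := 20 * (n + q n + r n) + qc (n + q n + r n + 2) + q n + 20.
exists (fun n => qi n + 10 * (n + q n + r n) + (r n + 1) * W n + q n + 40).
split=> //; first by rewrite /W; poly; case: pqc => ? [].
move=> x s s0; set n := tsize (eX x).
have [t1 [s1 [ex1 out1 fr1 le1]]] := Hi x s s0.
pose st k := foldl (step x) (init x) (take k (l x)).
have loop j k (s2 : store) : size (l x) = k + j -> s2 m = eX x ->
    s2 m.+1 = eS (st k) -> s2 m.+2 = enc_list eB (drop k (l x)) ->
  exists t s', [/\ exec (CWhile (EVar m.+2) body) s2 t s',
    s' m.+1 = eS (st (size (l x))), forall i, m.+3 <= i -> s' i = s2 i &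
    t <= j.+1 * W n].
  elim: j k s2 => [|j IH] k s2 szl s2m s2m1 s2m2.
    exists (ecost s2 (EVar m.+2)).+1, s2; split=> //.
    - by apply: ExecWhileFalse; rewrite /= s2m2 drop_oversize // szl addn0.
    - by rewrite s2m1 szl addn0.
    - by rewrite /= s2m2 drop_oversize ?szl ?addn0 //= /W; lia.
  have lt_k : k < size (l x) by rewrite szl; lia.
  have [b Eb] : exists b, drop k (l x) = b :: drop k.+1 (l x).
    case E : (drop k (l x)) => [|b l'].
      by move: (size_drop k (l x)); rewrite E /=; lia.
    by exists b; rewrite -addn1 addnC -drop_drop E /= drop0.
  have stS : st k.+1 = step x (st k) b.
    rewrite /st -addn1 takeD foldl_cat Eb /= take0 //.
  pose s3 := upd s2 0 (enc_pair eX (enc_pair eS eB) (x, (st k, b))).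
  have [t4 [s4 [ex4 out4 fr4 le4]]] := Hc (x, (st k, b)) s3 erefl.
  have E3 : eval s2 (ECons (EVar m) (ECons (EVar m.+1) (EHd (EVar m.+2)))) =
      enc_pair eX (enc_pair eS eB) (x, (st k, b)).
    by rewrite /= s2m s2m1 s2m2 Eb.
  have fr34 i : m <= i -> s4 i = s2 i.
    by move=> le; rewrite fr4 // /s3 /upd; case: eqP => // e; lia.
  pose s5 := upd s4 m.+1 (s4 0).
  have s5m2 : s5 m.+2 = enc_list eB (drop k (l x)).
    by rewrite /s5 /upd; case: eqP => e; [lia | rewrite fr34 //; lia].
  pose s6 := upd s5 m.+2 (eval s5 (ETl (EVar m.+2))).
  have [t7 [s7 [ex7 out7 fr7 le7]]] := IH k.+1 s6 ltac:(by lia) ltac:(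
     by rewrite /s6 /s5 /upd; do 2![case: eqP => [?|_]; first lia]; rewrite fr34)
     ltac:(by rewrite /s6 /s5 /upd eqxx; case: eqP => [?|_]; [lia|rewrite out4 stS])
     ltac:(by rewrite /s6 {1}/upd eqxx /= s5m2 Eb).
  have szk : tsize (eS (st k)) <= q n by apply: le_q.
  have szk1 : tsize (eS (st k.+1)) <= q n by apply: le_q.
  have szl' : tsize (enc_list eB (drop k (l x))) <= r n.
    exact: leq_trans (tsize_enc_list _ _ _) (le_r x).
  have szb : tsize (eB b) + tsize (enc_list eB (drop k.+1 (l x))) < r n.
    by move: szl'; rewrite Eb /enc_list /=; lia.
  exists (ecost s2 (EVar m.+2) + ((ecost s2 (ECons (EVar m) (ECons (EVar m.+1)
      (EHd (EVar m.+2))))).+1 + (t4 + ((ecost s4 (EVar 0)).+1 +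
      (ecost s5 (ETl (EVar m.+2))).+1).+1).+1).+1 + t7).+1, s7.
  split=> //.
  - apply: ExecWhileTrue ex7; first by rewrite /= s2m2 Eb.
    apply: ExecSeq; first exact: ExecAssign.
    rewrite E3 -/s3; apply: ExecSeq; first exact: ex4.
    by apply: ExecSeq; exact: ExecAssign.
  - move=> i le; rewrite fr7 // /s6 /s5 /upd.
    by do 2![case: eqP => [?|_]; first lia]; rewrite fr34 //; lia.
  - have le4' : t4 <= qc (n + q n + r n + 2).
      apply: leq_trans le4 _; case: pqc => mqc _; apply: mqc.
      by rewrite /= -/n; lia.
    rewrite /= !addn0 s2m s2m1 s2m2 s5m2 out4 /= -stS Eb /= -/n.
    rewrite mulSn {1}/W; move: le7 le4' szk szk1 szb.
    rewrite /enc_list /=; lia.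
pose s2 := upd s1 m (eX x).
have s20 : s2 0 = s1 0 by rewrite /s2 /upd; case: eqP => // e; lia.
pose s3 := upd s2 m.+1 (eS (init x)).
have s30 : s3 0 = s1 0 by rewrite /s3 /upd; case: eqP => // e; lia.
pose s4 := upd s3 m.+2 (enc_list eB (l x)).
have [t5 [s5 [ex5 out5 fr5 le5]]] := loop (size (l x)) 0 s4 (add0n _) ltac:(
   by rewrite /s4 /s3 /s2 /upd eqxx; do 2![case: eqP => [?|_]; first lia])
   ltac:(by rewrite /s4 /s3 /upd eqxx /st take0; case: eqP => [?|_]; first lia)
   ltac:(by rewrite /s4 /upd eqxx drop0).
exists (t1 + ((ecost s1 (EHd (EVar 0))).+1 + ((ecost s2 (EHd (ETl (EVar 0)))).+1 +
  ((ecost s3 (ETl (ETl (EVar 0)))).+1 + (t5 + (ecost s5 (EVar m.+1)).+1).+1).+1).+1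
  ).+1).+1, (upd s5 0 (s5 m.+1)); split.
- apply: ExecSeq; first exact: ex1.
  apply: ExecSeq; first exact: ExecAssign.
  have -> : eval s1 (EHd (EVar 0)) = eX x by rewrite /= out1.
  rewrite -/s2; apply: ExecSeq; first exact: ExecAssign.
  have -> : eval s2 (EHd (ETl (EVar 0))) = eS (init x) by rewrite /= s20 out1.
  rewrite -/s3; apply: ExecSeq; first exact: ExecAssign.
  have -> : eval s3 (ETl (ETl (EVar 0))) = enc_list eB (l x) by rewrite /= s30 out1.
  by rewrite -/s4; apply: ExecSeq; [exact: ex5 | exact: ExecAssign].
- by rewrite {1}/upd /= out5 /st take_size.
- move=> i le; rewrite /upd; case: eqP => [?|_]; first by lia.
  rewrite fr5 // /s4 /s3 /s2 /upd; do 3![case: eqP => [?|_]; first lia].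
  by rewrite fr1 //; lia.
- have szi : tsize (eS (init x)) <= q n by have := le_q x 0; rewrite take0.
  have szs : tsize (eS (st (size (l x)))) <= q n by apply: le_q.
  have szl : tsize (enc_list eB (l x)) <= r n by apply: le_r.
  have szl2 := size_enc_list eB (l x).
  have le5' : t5 <= (r n + 1) * W n.
    by apply: leq_trans le5 _; rewrite leq_mul2r; apply/orP; right; lia.
  rewrite /= !addn0 s20 s30 out1 out5 /=; rewrite -/n in le1 *; lia.
Qed.

(* [mu] measures the loop state; a step may only add an amount that is
   polynomial in the loop-invariant data, which excludes repeated doubling. *)
Lemma ptime_foldl_measure X S B eX eS eB (mu : S -> nat) (l : X -> seq B)
    (init : X -> S) (step : X -> S -> B -> S) q qi :
  polyb q -> polyb qi ->
  ptime eX (enc_list eB) l -> ptime eX eS init ->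
  ptime (enc_pair eX (enc_pair eS eB)) eS (fun p => step p.1 p.2.1 p.2.2) ->
  (forall s, tsize (eS s) <= mu s) ->
  (forall x, mu (init x) <= qi (tsize (eX x))) ->
  (forall x s b, mu (step x s b) <= mu s + q (tsize (eX x) + tsize (eB b))) ->
  ptime eX eS (fun x => foldl (step x) (init x) (l x)).
Proof.
move=> pq pqi Pl Pi Ps le_mu le_i le_s; have [r pr le_r] := ptime_size Pl.
have mq := pq.1.
apply: (@ptime_foldl _ _ _ _ _ eB _ _ _ (fun n => qi n + r n * q (n + r n))) => //.
  by poly.
move=> x k; set n := tsize (eX x); apply: leq_trans (le_mu _) _.
suff fold_le l' s : tsize (enc_list eB l') <= r n ->
    mu (foldl (step x) s l') <= mu s + size l' * q (n + r n).
  have le_take : tsize (enc_list eB (take k (l x))) <= r n.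
    apply: leq_trans (le_r x); elim: (l x) k => [|b l' IH] [|k] //=.
    by have := IH k; rewrite /enc_list /=; lia.
  apply: leq_trans (fold_le _ _ le_take) _; apply: leq_add; first exact: le_i.
  rewrite leq_mul2r; apply/orP; right; apply: leq_trans (le_take).
  by have := size_enc_list eB (take k (l x)); lia.
elim: l' s => [|b l' IH] s /=; rewrite ?addn0 // => le.
apply: leq_trans (IH _ _) _; first by rewrite /enc_list; lia.
rewrite mulSn addnA leq_add2r; apply: leq_trans (le_s _ _ _) _.
by rewrite leq_add2l; apply: mq; rewrite leq_add2l; lia.
Qed.

Lemma ptime_foldl_add X S B eX eS eB (l : X -> seq B)
    (init : X -> S) (step : X -> S -> B -> S) q :
  polyb q ->
  ptime eX (enc_list eB) l -> ptime eX eS init ->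
  ptime (enc_pair eX (enc_pair eS eB)) eS (fun p => step p.1 p.2.1 p.2.2) ->
  (forall x s b, tsize (eS (step x s b)) <=
     tsize (eS s) + q (tsize (eX x) + tsize (eB b))) ->
  ptime eX eS (fun x => foldl (step x) (init x) (l x)).
Proof.
move=> pq Pl Pi; have [qi pqi le_i] := ptime_size Pi => Ps le_s.
exact: (ptime_foldl_measure pq pqi Pl Pi Ps (mu := fun s => tsize (eS s))).
Qed.

Lemma ptime_comp2 A B C D eA eB eC eD (op : B -> C -> D) (f : A -> B) (g : A -> C) :
  ptime (enc_pair eB eC) eD (fun p => op p.1 p.2) ->
  ptime eA eB f -> ptime eA eC g -> ptime eA eD (fun x => op (f x) (g x)).
Proof. by move=> Po Pf Pg; apply: (ptime_comp Po (ptime_pair Pf Pg)). Qed.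

Lemma ptime_cons A B eA eB (f : A -> B) g :
  ptime eA eB f -> ptime eA (enc_list eB) g ->
  ptime eA (enc_list eB) (fun x => f x :: g x).
Proof. by move=> Pf Pg; apply: ptime_ext (ptime_pair Pf Pg). Qed.

Lemma ptime_nilp A B eA (eB : B -> tree) (f : A -> seq B) :
  ptime eA (enc_list eB) f -> ptime eA enc_bit (fun x => nilp (f x)).
Proof.
apply: (ptime_comp (g := fun s => nilp s)).
exists (CIf (EVar 0) (CAssign 0 ENil) (CAssign 0 (ECons ENil ENil))), 1.
exists (fun n => n + 10); split=> //; first by poly.
move=> l s s0; case: l s0 => [|b l] s0.
  exists (ecost s (EVar 0) + (ecost s (ECons ENil ENil)).+1).+1.
  exists (upd s 0 (TCons TNil TNil)); split=> //; last by rewrite /= s0.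
    by apply: ExecIfFalse; [rewrite /= s0 | exact: ExecAssign].
  by case.
exists (ecost s (EVar 0) + (ecost s ENil).+1).+1, (upd s 0 TNil).
split=> //; last by rewrite /= s0 /=; lia.
  by apply: ExecIfTrue; [rewrite /= s0 | exact: ExecAssign].
by case.
Qed.

Lemma ptime_head A B eA (eB : B -> tree) (d : A -> B) (f : A -> seq B) :
  ptime eA eB d -> ptime eA (enc_list eB) f -> ptime eA eB (fun x => head (d x) (f x)).
Proof.
move=> Pd Pf.
(* The head is first taken as a raw tree: on an empty list [EHd] returns [TNil], which may differ
   from the encoding of the default. *)
have Ph : ptime eA id (fun x => if enc_list eB (f x) is TCons h _ then h else TNil).
  apply: (ptime_comp (g := fun t => if enc_list eB t is TCons h _ then h else TNil)) Pf.
  by apply: (@ptime_expr _ _ _ _ _ (EHd (EVar 0))) => //= x s ->.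
have Pd' : ptime eA id (fun x => eB (d x)) by apply: ptime_ext Pd.
by apply: ptime_ext (ptime_if (ptime_nilp Pf) Pd' Ph) => x; case: (f x).
Qed.

Lemma ptime_behead A B eA (eB : B -> tree) (f : A -> seq B) :
  ptime eA (enc_list eB) f -> ptime eA (enc_list eB) (fun x => behead (f x)).
Proof.
apply: (ptime_comp (g := fun s => behead s)).
by apply: (@ptime_expr _ _ _ _ _ (ETl (EVar 0))) => //= x s ->; case: x.
Qed.

Lemma ptime_negb A eA (f : A -> bool) :
  ptime eA enc_bit f -> ptime eA enc_bit (fun x => ~~ f x).
Proof.
move=> Pf; exact: (ptime_if Pf (ptime_const _ _ false) (ptime_const _ _ true)).
Qed.

Lemma ptime_andb A eA (f g : A -> bool) :
  ptime eA enc_bit f -> ptime eA enc_bit g -> ptime eA enc_bit (fun x => f x && g x).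
Proof. move=> Pf Pg; exact: (ptime_if Pf Pg (ptime_const _ _ false)). Qed.

Lemma ptime_addb A eA (f g : A -> bool) :
  ptime eA enc_bit f -> ptime eA enc_bit g -> ptime eA enc_bit (fun x => f x (+) g x).
Proof.
by move=> Pf Pg; apply: ptime_ext (ptime_if Pf (ptime_negb Pg) Pg) => x; case: (f x).
Qed.

Ltac pt1 :=
  match goal with
  | H : ptime _ _ ?f |- ptime _ _ ?f => exact H
  | |- ptime _ _ (fun x => x) => exact: ptime_id
  | |- ptime _ _ fst => exact: (ptime_fst (ptime_id _))
  | |- ptime _ _ snd => exact: (ptime_snd (ptime_id _))
  | |- ptime _ _ (fun x => fst (@?f x)) => eapply (ptime_fst (f := f))
  | |- ptime _ _ (fun x => snd (@?f x)) => eapply (ptime_snd (f := f))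
  | |- ptime _ _ (fun x => (@?f x, @?g x)) =>
      eapply (ptime_pair (f := f) (g := g))
  | |- ptime _ _ (fun x => @?f x :: @?g x) =>
      eapply (ptime_cons (f := f) (g := g))
  | |- ptime _ _ (fun x => nilp (@?f x)) => eapply (ptime_nilp (f := f))
  | |- ptime _ _ (fun x => behead (@?f x)) => eapply (ptime_behead (f := f))
  | |- ptime _ _ (fun x => head (@?d x) (@?f x)) =>
      eapply (ptime_head (d := d) (f := f))
  | |- ptime _ _ (fun x => ~~ (@?f x)) => eapply (ptime_negb (f := f))
  | |- ptime _ _ (fun x => @?f x && @?g x) =>
      eapply (ptime_andb (f := f) (g := g))
  | |- ptime _ _ (fun x => @?f x (+) @?g x) =>
      eapply (ptime_addb (f := f) (g := g))
  | |- ptime _ _ (fun=> ?c) => exact: ptime_const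
  | |- _ => eapply ptime_if
  end.
Ltac pt := cbn beta; repeat (pt1; cbn beta).

(** * Lists *)

Lemma catrevE T (s t : seq T) : catrev s t = foldl (fun a b => b :: a) t s.
Proof. by elim: s t => //= x s IH t; rewrite IH. Qed.

Lemma ptime_catrev A B eA (eB : B -> tree) (f g : A -> seq B) :
  ptime eA (enc_list eB) f -> ptime eA (enc_list eB) g ->
  ptime eA (enc_list eB) (fun x => catrev (f x) (g x)).
Proof.
move=> Pf Pg; apply: (@ptime_ext _ _ _ _ (enc_list eB) _
  (fun x => foldl (fun a b => b :: a) (g x) (f x))).
  by move=> x; rewrite catrevE.
apply: (@ptime_foldl_add _ _ _ _ _ eB _ _ _ (fun n => n + 1)) => //; pt.
  by poly.
by move=> x s b; rewrite /enc_list /=; lia.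
Qed.

Lemma ptime_rev A B eA (eB : B -> tree) (f : A -> seq B) :
  ptime eA (enc_list eB) f -> ptime eA (enc_list eB) (fun x => rev (f x)).
Proof. by move=> Pf; apply: (ptime_catrev Pf); pt. Qed.

Lemma ptime_cat A B eA (eB : B -> tree) (f g : A -> seq B) :
  ptime eA (enc_list eB) f -> ptime eA (enc_list eB) g ->
  ptime eA (enc_list eB) (fun x => f x ++ g x).
Proof.
move=> Pf Pg; apply: ptime_ext (ptime_catrev (ptime_rev Pf) Pg) => x.
by rewrite catrevE foldl_rev -/(foldr _ _ _); congr enc_list; elim: (f x) => //= a s ->.
Qed.

Lemma tsize_enc_cat A (eA : A -> tree) s t :
  tsize (enc_list eA (s ++ t)) < tsize (enc_list eA s) + tsize (enc_list eA t).
Proof. by elim: s => [|a s IH] //=; rewrite /enc_list /= in IH *; lia. Qed.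

Lemma ptime_flatten A B eA (eB : B -> tree) (f : A -> seq (seq B)) :
  ptime eA (enc_list (enc_list eB)) f ->
  ptime eA (enc_list eB) (fun x => flatten (f x)).
Proof.
move=> Pf; apply: (@ptime_ext _ _ _ _ (enc_list eB) _
  (fun x => foldl (fun a b => a ++ b) [::] (f x))).
  move=> x; congr enc_list; rewrite -[RHS]cat0s.
  by elim: (f x) [::] => [|b s IH] a /=; rewrite ?cats0 // IH catA.
apply: (@ptime_foldl_add _ _ _ _ _ (enc_list eB) _ _ _ (fun n => n)) => //; pt.
  by poly.
  by apply: ptime_cat; pt.
by move=> x s b; have := tsize_enc_cat eB s b; lia.
Qed.

Lemma ptime_map X B C eX eB eC (f : X -> B -> C) (l : X -> seq B) :
  ptime (enc_pair eX eB) eC (fun p => f p.1 p.2) ->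
  ptime eX (enc_list eB) l -> ptime eX (enc_list eC) (fun x => map (f x) (l x)).
Proof.
move=> Pf Pl; have [r pr le_r] := ptime_size Pf.
have mr := pr.1.
apply: (@ptime_ext _ _ _ _ (enc_list eC) _
  (fun x => rev (foldl (fun a b => f x b :: a) [::] (l x)))).
  move=> x; congr enc_list; rewrite -(revK (map _ _)); congr rev.
  rewrite /rev catrevE; elim: (l x) [::] => //= b s IH a; exact: IH.
apply: ptime_rev.
apply: (@ptime_foldl_add _ _ _ _ _ eB _ _ _ (fun n => r (n + 1) + 1)) => //; pt.
  by poly.
  by apply: ptime_comp2 Pf _ _; pt.
move=> x s b; rewrite /enc_list /=; have := le_r (x, b).
have := mr (tsize (enc_pair eX eB (x, b))) (tsize (eX x) + tsize (eB b) + 1).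
by rewrite /enc_pair /=; lia.
Qed.

Lemma ptime_filter X B eX eB (f : X -> B -> bool) (l : X -> seq B) :
  ptime (enc_pair eX eB) enc_bit (fun p => f p.1 p.2) ->
  ptime eX (enc_list eB) l -> ptime eX (enc_list eB) (fun x => filter (f x) (l x)).
Proof.
move=> Pf Pl.
apply: (@ptime_ext _ _ _ _ (enc_list eB) _
  (fun x => rev (foldl (fun a b => if f x b then b :: a else a) [::] (l x)))).
  move=> x; congr enc_list; rewrite -(revK (filter _ _)); congr rev.
  rewrite /rev catrevE; elim: (l x) [::] => //= b s IH a.
  by rewrite IH; case: (f x b).
apply: ptime_rev.
apply: (@ptime_foldl_add _ _ _ _ _ eB _ _ _ (fun n => n + 1)) => //; pt.
  by poly.
  by apply: ptime_comp2 Pf _ _; pt.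
by move=> x s b; case: (f x b); rewrite /enc_list /=; lia.
Qed.

(** * Unary numbers as loop counters *)

Definition enc_un (n : nat) : tree := enc_list (fun=> TNil) (nseq n tt).

Lemma tsize_un n : tsize (enc_un n) = n.*2.+1.
Proof. by elim: n => //= n IH; rewrite /enc_un /enc_list /= in IH *; lia. Qed.

Lemma ptime_iter X S eX eS (n : X -> nat) (init : X -> S) (step : X -> S -> S) q :
  polyb q ->
  ptime eX enc_un n -> ptime eX eS init ->
  ptime (enc_pair eX eS) eS (fun p => step p.1 p.2) ->
  (forall x k, k <= n x -> tsize (eS (iter k (step x) (init x))) <= q (tsize (eX x))) ->
  ptime eX eS (fun x => iter (n x) (step x) (init x)).
Proof.
have foldE k x (step' : X -> S -> S) s :
    foldl (fun s _ => step' x s) s (nseq k tt) = iter k (step' x) s.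
  by elim: k s => //= k IH s; rewrite IH -iterSr.
move=> pq Pn Pi Ps le_q.
apply: (@ptime_ext _ _ _ _ eS _
  (fun x => foldl (fun s _ => step x s) (init x) (nseq (n x) tt))).
  by move=> x; rewrite foldE.
apply: (@ptime_foldl _ _ _ _ _ (fun=> TNil) _ _ _ q) => //.
  by apply: ptime_comp2 Ps _ _; pt.
move=> x k; have -> : take k (nseq (n x) tt) = nseq (minn k (n x)) tt.
  by elim: k (n x) => [|k IH] [|m] //=; rewrite ?min0n // minnSS /= IH.
by rewrite foldE; apply: le_q; rewrite geq_minr.
Qed.

Lemma ptime_iter_measure X S eX eS mu (n : X -> nat) (init : X -> S)
    (step : X -> S -> S) q qi :
  polyb q -> polyb qi ->
  ptime eX enc_un n -> ptime eX eS init ->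
  ptime (enc_pair eX eS) eS (fun p => step p.1 p.2) ->
  (forall s, tsize (eS s) <= mu s) ->
  (forall x, mu (init x) <= qi (tsize (eX x))) ->
  (forall x s, mu (step x s) <= mu s + q (tsize (eX x))) ->
  ptime eX eS (fun x => iter (n x) (step x) (init x)).
Proof.
move=> pq pqi Pn Pi Ps le_mu le_i le_s; have [r pr le_r] := ptime_size Pn.
apply: (@ptime_iter _ _ _ _ _ _ _ (fun n => qi n + r n * q n)) => //; first by poly.
move=> x k le_k; apply: leq_trans (le_mu _) _; set m := tsize (eX x).
have {}le_k : k <= r m by have := le_r x; rewrite tsize_un -/m; lia.
apply: (@leq_trans (qi m + k * q m)); last by rewrite leq_add2l leq_mul2r le_k orbT.
elim: {le_k}k => [|k IH] /=; first by rewrite addn0 le_i.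
by apply: leq_trans (le_s _ _) _; rewrite mulSn -/m; lia.
Qed.

Lemma ptime_un_succ A eA (f : A -> nat) :
  ptime eA enc_un f -> ptime eA enc_un (fun x => (f x).+1).
Proof.
by move=> Pf; apply: ptime_ext (ptime_pair (ptime_const eA id TNil) Pf).
Qed.

Lemma ptime_un_pred A eA (f : A -> nat) :
  ptime eA enc_un f -> ptime eA enc_un (fun x => (f x).-1).
Proof.
move=> Pf; have Pl : ptime eA (enc_list (fun=> TNil)) (fun x => nseq (f x) tt) by [].
by apply: ptime_ext (ptime_behead Pl) => x; case: (f x).
Qed.

Lemma ptime_un_size A B eA (eB : B -> tree) (f : A -> seq B) :
  ptime eA (enc_list eB) f -> ptime eA enc_un (fun x => size (f x)).
Proof.
move=> Pf; apply: (@ptime_ext _ _ _ _ enc_un _ (fun x => foldl (fun s _ => s.+1) 0 (f x))).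
  move=> x; congr enc_un; rewrite -[RHS]addn0.
  by elim: (f x) 0 => //= b s IH n; rewrite IH addSn addnS.
apply: (@ptime_foldl_add _ _ _ _ _ eB _ _ _ (fun n => 2)) => //; pt; first by poly.
  by apply: ptime_un_succ; pt.
by move=> x s b; rewrite !tsize_un; lia.
Qed.

Lemma ptime_un_add A eA (f g : A -> nat) :
  ptime eA enc_un f -> ptime eA enc_un g -> ptime eA enc_un (fun x => f x + g x).
Proof.
move=> Pf Pg; have [r pr le_r] := ptime_size Pg.
apply: (@ptime_ext _ _ _ _ enc_un _ (fun x => iter (f x) succn (g x))).
  by move=> x; rewrite iter_succn addnC.
apply: (@ptime_iter_measure _ _ _ _ (fun n => tsize (enc_un n)) _ _ _ (fun=> 2) r) => //.
- by poly.
- by apply: ptime_un_succ; pt.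
- by move=> x s; rewrite !tsize_un; lia.
Qed.

Lemma ptime_un_mul A eA (f g : A -> nat) :
  ptime eA enc_un f -> ptime eA enc_un g -> ptime eA enc_un (fun x => f x * g x).
Proof.
move=> Pf Pg; have [r pr le_r] := ptime_size Pg.
apply: (@ptime_ext _ _ _ _ enc_un _ (fun x => iter (f x) (addn (g x)) 0)).
  by move=> x; rewrite iter_addn_0 mulnC.
apply: (@ptime_iter_measure _ _ _ _ (fun n => tsize (enc_un n)) _ _ _ r (fun=> 1)) => //.
- by poly.
- by pt.
- by apply: ptime_un_add; pt; apply: (ptime_comp Pg); pt.
- by move=> x s; have := le_r x; rewrite !tsize_un; lia.
Qed.

Lemma ptime_un_ltn A eA (f g : A -> nat) :
  ptime eA enc_un f -> ptime eA enc_un g -> ptime eA enc_bit (fun x => f x < g x).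
Proof.
move=> Pf Pg; have [r pr le_r] := ptime_size Pg.
have Psub : ptime eA enc_un (fun x => g x - f x).
  apply: (@ptime_ext _ _ _ _ enc_un _ (fun x => iter (f x) predn (g x))).
    by move=> x; rewrite iter_predn.
  apply: (@ptime_iter_measure _ _ _ _ (fun n => tsize (enc_un n)) _ _ _ (fun=> 0) r) => //.
  - by poly.
  - by apply: ptime_un_pred; pt.
  - by move=> x s; rewrite !tsize_un; lia.
have Pl : ptime eA (enc_list (fun=> TNil)) (fun x => nseq (g x - f x) tt) by [].
apply: ptime_ext (ptime_negb (ptime_nilp Pl)) => x.
by rewrite /nilp size_nseq subn_eq0 ltnNge.
Qed.

(** * Binary arithmetic *)

Local Notation enc_bits := (enc_list enc_bit).

Lemma tsize_bits s : tsize (enc_bits s) <= 4 * size s + 1.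
Proof. by elim: s => [|[] s IH] //=; rewrite /enc_list /= in IH *; lia. Qed.

(** Leading zeros are allowed, so [badd] and [bmul] need not normalise their results, which are only
    compared. *)
Fixpoint bval (s : seq bool) : nat := if s is b :: s' then b + (bval s').*2 else 0.

Lemma bits_of_natK n : bval (bits_of_nat n) = n.
Proof.
rewrite /bits_of_nat -[in RHS](bin_of_natK n); case: (bin_of_nat n) => //= p.
by elim: p => //= p ->; rewrite /= -?NatTrec.doubleE ?add1n.
Qed.

(** Unlike [badd], adding 1 this way creates no leading zero, as the encoding [enc_nat] of the
    successor requires. *)
Fixpoint incr (c : bool) (s : seq bool) : seq bool :=
  if s is b :: s' then (c (+) b) :: incr (c && b) s' else if c then [:: true] else [::].

Lemma incr0 s : incr false s = s.
Proof. by elim: s => //= b s ->. Qed.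

Lemma bits_of_nat_succ n : bits_of_nat n.+1 = incr true (bits_of_nat n).
Proof.
rewrite /bits_of_nat -[n in bin_of_nat n.+1](bin_of_natK n).
case: (bin_of_nat n) => // p.
rewrite -[(nat_of_bin _).+1]/(nat_of_pos p).+1 -nat_of_succ_pos.
rewrite -[nat_of_pos _]/(nat_of_bin (Npos (Pos.succ p))) nat_of_binK.
by elim: p => [p /= ->|p _|] //=; rewrite incr0.
Qed.

Lemma size_bits_of_nat n : size (bits_of_nat n) <= n.
Proof.
elim: n => // n IH; rewrite bits_of_nat_succ.
apply: leq_trans (_ : _ <= (size (bits_of_nat n)).+1) _ => //.
by elim: (bits_of_nat n) true {IH} => [[]|b s IH c] //=; rewrite ltnS.
Qed.

Lemma tsize_nat n : tsize (enc_nat n) <= 4 * n + 1.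
Proof.
by apply: leq_trans (tsize_bits _) _; have := size_bits_of_nat n; lia.
Qed.

Lemma ptime_bits A eA (f : A -> nat) :
  ptime eA enc_nat f -> ptime eA enc_bits (fun x => bits_of_nat (f x)).
Proof. exact: ptime_ext. Qed.

Lemma ptime_succ A eA (f : A -> nat) :
  ptime eA enc_nat f -> ptime eA enc_nat (fun x => (f x).+1).
Proof.
move=> Pf; pose g (st : bool * seq bool) b := (st.1 && b, (st.1 (+) b) :: st.2).
pose st x := foldl g (true, [::]) (bits_of_nat (f x)).
have Pst : ptime eA (enc_pair enc_bit enc_bits) st.
  apply: (@ptime_foldl_add _ _ _ _ _ enc_bit _ _ (fun=> g) (fun=> 10)); first by poly.
  - exact: ptime_bits.
  - by pt.
  - by rewrite /g; pt.
  - by move=> _ [[] s] []; rewrite /g /enc_pair /enc_list /=; lia.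
have Pr : ptime eA enc_bits
    (fun x => if (st x).1 then rev (true :: (st x).2) else rev (st x).2).
  by apply: ptime_if; [|apply: ptime_rev|apply: ptime_rev]; pt.
apply: ptime_ext Pr => x; rewrite {Pst}/st /enc_nat bits_of_nat_succ.
suff H s c acc : (let st := foldl g (c, acc) s in
    if st.1 then rev (true :: st.2) else rev st.2) = rev acc ++ incr c s.
  by congr enc_list; apply: H.
elim: s c acc => [|b s IH] c acc.
  2: by apply: etrans (IH _ _) _; rewrite rev_cons cat_rcons.
by case: c; rewrite /= ?cats0 // rev_cons cats1.
Qed.

(** Both numbers are padded with zeros to a common length. The generous length is that of [x ++ y],
    so that a fold over the concatenation can drive the traversal. *)
Definition pzip (x y : seq bool) : seq (bool * bool) :=
  mkseq (fun i => (nth false x i, nth false y i)) (size x + size y).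

Lemma ptime_pzip A eA (f g : A -> seq bool) :
  ptime eA enc_bits f -> ptime eA enc_bits g ->
  ptime eA (enc_list (enc_pair enc_bit enc_bit)) (fun x => pzip (f x) (g x)).
Proof.
move=> Pf Pg.
pose h (st : seq bool * (seq bool * seq (bool * bool))) (b : bool) :=
  (behead st.1, (behead st.2.1, (head false st.1, head false st.2.1) :: st.2.2)).
apply: (@ptime_ext _ _ _ _ (enc_list (enc_pair enc_bit enc_bit)) _
  (fun x => rev (foldl h (f x, (g x, [::])) (f x ++ g x)).2.2)).
  move=> x; congr enc_list; rewrite /pzip -size_cat.
  elim/last_ind: (f x ++ g x) => [|s b IH]; first by [].
  rewrite foldl_rcons size_rcons mkseqS /= rev_cons IH; congr rcons.
  set st := foldl _ _ _.
  have [-> ->] : st.1 = drop (size s) (f x) /\ st.2.1 = drop (size s) (g x).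
    rewrite {}/st {IH}; elim/last_ind: s => [|s c [IH1 IH2]]; first by rewrite !drop0.
    rewrite foldl_rcons size_rcons /= IH1 IH2 -!drop1 !drop_drop; split; congr drop; lia.
  by rewrite -!nth0 !nth_drop !addn0.
apply: ptime_rev; apply: ptime_snd; apply: ptime_snd.
apply: (@ptime_foldl_add _ _ _ _ _ enc_bit _ _ (fun=> h) (fun=> 10)).
- by poly.
- exact: ptime_cat.
- by pt.
- by rewrite /h; pt.
- move=> _ [x [y z]] b; have := tsize_enc_list enc_bit x 1.
  have := tsize_enc_list enc_bit y 1; rewrite !drop1 /h /enc_pair /=.
  by case: (head false x); case: (head false y); rewrite /enc_list /=; lia.
Qed.

Lemma bval_mkseq n x : size x <= n -> bval (mkseq (nth false x) n) = bval x.
Proof.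
rewrite /mkseq; elim: n x => [|n IH] [|b x] //= le.
  rewrite -[1]/(1 + 0) iotaDl -map_comp.
  by rewrite (eq_map (g := nth false [::])) ?(IH [::]) // => i; rewrite /= !nth_nil.
by rewrite -[1]/(1 + 0) iotaDl -map_comp (eq_map (g := nth false x)) ?(IH x).
Qed.

Lemma bval_unzip1 x y : bval (unzip1 (pzip x y)) = bval x.
Proof. by rewrite /unzip1 /pzip -map_comp bval_mkseq ?leq_addr. Qed.

Lemma bval_unzip2 x y : bval (unzip2 (pzip x y)) = bval y.
Proof. by rewrite /unzip2 /pzip -map_comp bval_mkseq ?leq_addl. Qed.

(** Ripple-carry addition; the new carry is the majority of the two bits and [c]. *)
Fixpoint addz (c : bool) (z : seq (bool * bool)) : seq bool :=
  if z is ab :: z' then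
    (c (+) (ab.1 (+) ab.2)) :: addz (if ab.1 (+) ab.2 then c else ab.1) z'
  else [:: c].

Definition badd (x y : seq bool) := addz false (pzip x y).

Lemma baddE x y : bval (badd x y) = bval x + bval y.
Proof.
suff H c z : bval (addz c z) = c + bval (unzip1 z) + bval (unzip2 z).
  by rewrite /badd H bval_unzip1 bval_unzip2.
by elim: z c => [|[[] []] z IH] [] //=; rewrite IH /=; lia.
Qed.

Lemma size_badd x y : size (badd x y) = (size x + size y).+1.
Proof.
suff H c z : size (addz c z) = (size z).+1 by rewrite /badd H size_mkseq.
by elim: z c => //= ab z IH c; rewrite IH.
Qed.

Lemma ptime_badd A eA (f g : A -> seq bool) :
  ptime eA enc_bits f -> ptime eA enc_bits g ->
  ptime eA enc_bits (fun x => badd (f x) (g x)).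
Proof.
move=> Pf Pg.
pose h (st : bool * seq bool) (ab : bool * bool) :=
  ((if ab.1 (+) ab.2 then st.1 else ab.1), (st.1 (+) (ab.1 (+) ab.2)) :: st.2).
pose st x := foldl h (false, [::]) (pzip (f x) (g x)).
have Pst : ptime eA (enc_pair enc_bit enc_bits) st.
  apply: (@ptime_foldl_add _ _ _ _ _ (enc_pair enc_bit enc_bit) _ _ (fun=> h)
    (fun=> 10)); first by poly.
  - exact: ptime_pzip.
  - by pt.
  - by rewrite /h; pt.
  - by move=> _ [[] s] [[] []]; rewrite /h /enc_pair /enc_list /=; lia.
have Pr : ptime eA enc_bits (fun x => rev ((st x).1 :: (st x).2)).
  by apply: ptime_rev; pt.
apply: ptime_ext Pr => x; congr enc_list; rewrite {Pst}/st /badd.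
suff H z c acc : (let st := foldl h (c, acc) z in rev (st.1 :: st.2)) =
    rev acc ++ addz c z by apply: H.
elim: z c acc => [|b s IH] c acc; first by rewrite /= rev_cons cats1.
by apply: etrans (IH _ _) _; rewrite rev_cons cat_rcons.
Qed.

(** Horner's scheme, from the most significant bit of [x] down. *)
Definition bmul (x y : seq bool) :=
  foldl (fun acc b => badd (false :: acc) (if b then y else [::])) [::] (rev x).

Lemma bmulE x y : bval (bmul x y) = bval x * bval y.
Proof.
rewrite /bmul; elim: x => [|b x IH]; first by [].
by rewrite rev_cons foldl_rcons baddE /= IH; case: b; rewrite /=; lia.
Qed.

Lemma ptime_bmul A eA (f g : A -> seq bool) :
  ptime eA enc_bits f -> ptime eA enc_bits g ->
  ptime eA enc_bits (fun x => bmul (f x) (g x)).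
Proof.
move=> Pf Pg; have [r pr le_r] := ptime_size Pg.
(* The measure is taken from the length of the accumulator: the length of a [badd] does not depend
   on the bits, and a step adds at most [size (g x) + 2] to it. *)
apply: (@ptime_foldl_measure _ _ _ _ _ enc_bit (fun s => 4 * size s + 1)
  (fun x => rev (f x)) (fun=> [::])
  (fun x acc b => badd (false :: acc) (if b then g x else [::]))
  (fun n => 4 * r n + 8) (fun=> 1)) => //.
- by poly.
- by poly.
- exact: ptime_rev.
- by pt.
- by apply: ptime_badd; pt; apply: (ptime_comp Pg); pt.
- exact: tsize_bits.
- move=> x s b; rewrite size_badd /=.
  have le1 : size (if b then g x else [::]) <= r (tsize (eA x) + tsize (enc_bit b)).
    case: b => //=; apply: leq_trans (_ : r (tsize (eA x)) <= _).
      by have := le_r x; have := size_enc_list enc_bit (g x); lia.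
    by apply: pr.1; rewrite leq_addr.
  by lia.
Qed.

(** Bits are read from the least significant one up, so the last differing position decides. *)
Definition blt (x y : seq bool) :=
  foldl (fun r ab => if ab.1 (+) ab.2 then ab.2 else r) false (pzip x y).

Lemma bltE x y : blt x y = (bval x < bval y).
Proof.
rewrite -(bval_unzip1 x y) -[in RHS](bval_unzip2 x y) /blt.
(* The verdict [r] on the lower bits acts as one extra unit on the right. *)
suff H z r : foldl (fun r (ab : bool * bool) => if ab.1 (+) ab.2 then ab.2 else r) r z =
   (bval (unzip1 z) < bval (unzip2 z) + r) by rewrite H addn0.
elim: z r => [|[[] []] z IH] r /=; first by case: r.
all: by rewrite IH; case: r => /=; lia.
Qed.

Lemma ptime_blt A eA (f g : A -> seq bool) :
  ptime eA enc_bits f -> ptime eA enc_bits g ->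
  ptime eA enc_bit (fun x => blt (f x) (g x)).
Proof.
move=> Pf Pg.
apply: (@ptime_foldl_add _ _ _ _ _ (enc_pair enc_bit enc_bit) _ _ (fun _ (r : bool)
   (ab : bool * bool) => if ab.1 (+) ab.2 then ab.2 else r) (fun=> 10)).
- by poly.
- exact: ptime_pzip.
- by pt.
- by pt.
- by move=> _ [] [[] []].
Qed.

Lemma ptime_ltn A eA (f g : A -> nat) :
  ptime eA enc_nat f -> ptime eA enc_nat g -> ptime eA enc_bit (fun x => f x < g x).
Proof.
move=> /ptime_bits Pf /ptime_bits Pg; apply: ptime_ext (ptime_blt Pf Pg) => x.
by rewrite bltE !bits_of_natK.
Qed.

Lemma ptime_eqn A eA (f g : A -> nat) :
  ptime eA enc_nat f -> ptime eA enc_nat g -> ptime eA enc_bit (fun x => f x == g x).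
Proof.
move=> Pf Pg.
have Pn := ptime_andb (ptime_negb (ptime_ltn Pf Pg)) (ptime_negb (ptime_ltn Pg Pf)).
by apply: ptime_ext Pn => x; congr enc_bit; lia.
Qed.

Lemma ptime_nat_of_un A eA (f : A -> nat) :
  ptime eA enc_un f -> ptime eA enc_nat f.
Proof.
move=> Pf; apply: (@ptime_ext _ _ _ _ enc_nat _ (fun x => iter (f x) succn 0)).
  by move=> x; rewrite iter_succn.
apply: (@ptime_iter_measure _ _ _ _ (fun n => 4 * n + 1) _ _ _ (fun=> 4) (fun=> 1)) => //.
- by poly.
- by poly.
- by pt.
- by apply: ptime_succ; pt.
- exact: tsize_nat.
- by move=> x s; lia.
Qed.

Lemma ptime_iota A eA (f : A -> nat) :
  ptime eA enc_un f -> ptime eA (enc_list enc_nat) (fun x => iota 0 (f x)).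
Proof.
move=> Pf; have [r pr le_r] := ptime_size Pf.
pose h (st : nat * seq nat) := (st.1.+1, st.1 :: st.2).
have hE k : iter k h (0, [::]) = (k, rev (iota 0 k)).
  by elim: k => // k IH; rewrite iterS IH -[in RHS]addn1 iotaD rev_cat addn1.
apply: (@ptime_ext _ _ _ _ (enc_list enc_nat) _ (fun x => rev (iter (f x) h (0, [::])).2)).
  by move=> x; rewrite hE revK.
apply: ptime_rev; apply: ptime_snd.
apply: (@ptime_iter _ _ _ (enc_pair enc_nat (enc_list enc_nat)) f
  (fun=> (0, [::])) (fun=> h)
  (fun n => (r n + 1) * (4 * r n + 10))) => //.
- by poly.
- by pt.
- by rewrite /h; pt; apply: ptime_succ; pt.
- move=> x k le_k; have {le_k} le_k : k <= r (tsize (eA x)).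
    by have := le_r x; rewrite tsize_un; lia.
  apply: (@leq_trans ((k + 1) * (4 * k + 10))); last by apply: leq_mul; lia.
  rewrite hE /enc_pair /=; have := tsize_nat k.
  suff : tsize (enc_list enc_nat (rev (iota 0 k))) <= k * (4 * k + 2) + 1 by lia.
  elim: {le_k}k => // k IH; rewrite -addn1 iotaD rev_cat /= /enc_list /= add0n.
  by have := tsize_nat k; rewrite /enc_list in IH; nia.
Qed.

(** Out-of-range indices are sent to the first element. *)
Definition lookup (T : Type) (x0 : T) (s : seq T) (i : nat) := nth (head x0 s) s i.

Lemma ptime_lookup A B eA eB x0 (s : A -> seq B) (i : A -> nat) :
  ptime eA (enc_list eB) s -> ptime eA enc_nat i ->
  ptime eA eB (fun x => lookup x0 (s x) (i x)).
Proof.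
move=> Ps Pi; have [r pr le_r] := ptime_size Ps.
pose h x (st : nat * B) b := (st.1.+1, if st.1 == i x then b else st.2).
apply: (@ptime_ext _ _ _ _ eB _ (fun x => (foldl (h x) (0, head x0 (s x)) (s x)).2)).
  move=> x; congr eB; rewrite /lookup; move: (head _ _) => d.
  suff H k l : (foldl (h x) (k, d) l).2 = if k <= i x then nth d l (i x - k) else d.
    by rewrite H subn0.
  elim: l k d => [|b l IH] k d /=; first by rewrite nth_nil if_same.
  rewrite {2}/h /= IH; case: ltngtP => [lt|lt|<-].
  - by rewrite -(subnSK lt).
  - by [].
  - by rewrite subnn.
apply: ptime_snd.
apply: (@ptime_foldl_measure _ _ _ _ (enc_pair enc_nat eB) eB
  (fun st => 4 * st.1 + 2 + tsize (eB st.2)) s (fun x => (0, head x0 (s x))) h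
  (fun n => n + 4) (fun n => r n + 2 + tsize (eB x0))) => //.
- by poly.
- by poly.
- by pt.
- rewrite /h; pt; first by apply: ptime_succ; pt.
  by apply: ptime_eqn; pt; apply: (ptime_comp Pi); pt.
- by move=> [k b]; have := tsize_nat k; rewrite /enc_pair /=; lia.
- move=> x /=; have := le_r x; case: (s x) => [|b l]; rewrite /enc_list /=; lia.
- by move=> x [k c] b; rewrite /h /=; case: eqP => _; lia.
Qed.

(** * Rationals *)

Lemma ptime_numq A eA (f : A -> rat) :
  ptime eA enc_rat f -> ptime eA enc_nat (fun x => `|numq (f x)|%N).
Proof.
move=> Pf; have Pp : ptime eA (enc_pair enc_nat enc_nat)
  (fun x => (`|numq (f x)|%N, `|denq (f x)|%N)) by apply: ptime_ext Pf.
exact: ptime_fst Pp.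
Qed.

Lemma ptime_denq A eA (f : A -> rat) :
  ptime eA enc_rat f -> ptime eA enc_nat (fun x => `|denq (f x)|%N).
Proof.
move=> Pf; have Pp : ptime eA (enc_pair enc_nat enc_nat)
  (fun x => (`|numq (f x)|%N, `|denq (f x)|%N)) by apply: ptime_ext Pf.
exact: ptime_snd Pp.
Qed.

Lemma ptime_rat_of_nat A eA (f : A -> nat) :
  ptime eA enc_nat f -> ptime eA enc_rat (fun x => (f x)%:R%R).
Proof.
move=> Pf; apply: ptime_ext (ptime_pair Pf (ptime_const eA enc_nat 1)) => x.
by rewrite /enc_rat pmulrn numq_int denq_int.
Qed.

(** Stands for [i < K c / D], cross-multiplied so that [D = 0] is no special case and the test
    becomes one between products of naturals. The absolute values make it a function of the
    encoding, since [enc_rat] stores no sign. *)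
Definition ratio_lt (i K : nat) (D c : rat) : bool :=
  (i%:R * `|D| < K%:R * `|c|)%R.

Lemma ratio_ltE i K D c : ratio_lt i K D c =
  (i * `|numq D| * `|denq c| < K * `|numq c| * `|denq D|)%N.
Proof.
have normE (q : rat) : (`|q| = `|numq q|%N%:R / `|denq q|%N%:R)%R.
  by rewrite -{1}[q]divq_num_den normrM normfV !pmulrn -!intr_norm !abszE.
have den0 (q : rat) : (0 < `|denq q|%N%:R :> rat)%R.
  by rewrite ltr0n absz_gt0 denq_neq0.
rewrite /ratio_lt !normE !mulrA ltr_pdivrMr // mulrAC ltr_pdivlMr //.
by rewrite -!natrM ltr_nat.
Qed.

Lemma ptime_ratio_lt A eA (i K : A -> nat) (D c : A -> rat) :
  ptime eA enc_nat i -> ptime eA enc_nat K ->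
  ptime eA enc_rat D -> ptime eA enc_rat c ->
  ptime eA enc_bit (fun x => ratio_lt (i x) (K x) (D x) (c x)).
Proof.
move=> Pi PK PD Pc.
have P1 := ptime_bmul (ptime_bmul (ptime_bits Pi) (ptime_bits (ptime_numq PD)))
  (ptime_bits (ptime_denq Pc)).
have P2 := ptime_bmul (ptime_bmul (ptime_bits PK) (ptime_bits (ptime_numq Pc)))
  (ptime_bits (ptime_denq PD)).
apply: ptime_ext (ptime_blt P1 P2) => x.
by rewrite bltE !bmulE !bits_of_natK ratio_ltE.
Qed.

(** * The rounded instance *)

Definition pad (T : nat) : nat := iter T (fun x => if x < T then (x + x).+1 else x) 0.

(** Below [T] a step gains at least 1. A step that changes the value starts below [T], so the result
    stays linear in [T] and can be kept in unary. *)
Lemma pad_itv T k : (k <= T)%N ->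
  k <= iter k (fun x => if x < T then (x + x).+1 else x) 0 <= T.*2.
Proof. by elim: k => //= k IH lt_kT; case: ifP (IH (ltnW lt_kT)); lia. Qed.

Lemma leq_pad T : T <= pad T.
Proof. by have /andP[] := pad_itv (leqnn T). Qed.

Lemma pad_pow2 T : exists k, pad T = 2 ^ k - 1.
Proof.
rewrite /pad; elim: {1}T => [|j [k IH]] /=; first by exists 0.
case: ifP => _; last by exists k.
by exists k.+1; rewrite IH expnS; have := expn_gt0 2 k; lia.
Qed.

Lemma ptime_pad A eA (f : A -> nat) :
  ptime eA enc_un f -> ptime eA enc_un (fun x => pad (f x)).
Proof.
move=> Pf; have [r pr le_r] := ptime_size Pf.
apply: (@ptime_iter _ _ _ _ f (fun=> 0)
  (fun x y => if y < f x then (y + y).+1 else y) (fun n => 4 * r n + 1)) => //.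
- by poly.
- by pt.
- pt.
  + by apply: ptime_un_ltn; pt; apply: (ptime_comp Pf); pt.
  + by apply: ptime_un_succ; apply: ptime_un_add; pt.
- move=> x k le_k; have := le_r x; have /andP[_] := pad_itv le_k.
  by rewrite !tsize_un; lia.
Qed.

(* [min (ceil (K c / D), L)], also for [D = 0], where the value is [0] or [L]. *)
Definition round (K L : nat) (D c : rat) : nat :=
  iter L (fun i => if ratio_lt i K D c then i.+1 else i) 0.

Lemma ptime_round A eA (K L : A -> nat) (D c : A -> rat) :
  ptime eA enc_un K -> ptime eA enc_un L ->
  ptime eA enc_rat D -> ptime eA enc_rat c ->
  ptime eA enc_nat (fun x => round (K x) (L x) (D x) (c x)).
Proof.
move=> /ptime_nat_of_un PK PL PD Pc.
apply: (@ptime_iter_measure _ _ _ _ (fun n => 4 * n + 1) L (fun=> 0)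
  (fun x i => if ratio_lt i (K x) (D x) (c x) then i.+1 else i)
  (fun=> 4) (fun=> 1)) => //.
- by poly.
- by poly.
- by pt.
- pt; last by apply: ptime_succ; pt.
  by apply: ptime_ratio_lt; pt; [apply: (ptime_comp PK) | apply: (ptime_comp PD)
    | apply: (ptime_comp Pc)]; pt.
- exact: tsize_nat.
- by move=> x s; case: ifP; lia.
Qed.

Definition entry (M : seq (seq rat)) (i j : nat) : rat :=
  lookup 0%R (lookup [::] M i) j.

Local Notation enc_mat := (enc_list (enc_list enc_rat)).

Lemma ptime_entry A eA (M : A -> seq (seq rat)) (i j : A -> nat) :
  ptime eA enc_mat M -> ptime eA enc_nat i -> ptime eA enc_nat j ->
  ptime eA enc_rat (fun x => entry (M x) (i x) (j x)).
Proof. by move=> PM Pi Pj; do 2![apply: ptime_lookup => //]. Qed.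

(** [size M] also counts the source, so the result is at least [n + 10]. *)
Definition nvert (M : seq (seq rat)) : nat := pad (size M + 9).
Definition scale (E N : nat) : nat := 2 * N * N * E.
Definition cap (E N : nat) : nat := 2 * N * N * scale E N * E.

Lemma ptime_nvert A eA (M : A -> seq (seq rat)) :
  ptime eA enc_mat M -> ptime eA enc_un (fun x => nvert (M x)).
Proof.
by move=> PM; apply/ptime_pad/ptime_un_add; [apply: ptime_un_size PM | pt].
Qed.

Lemma ptime_scale A eA (E : nat) (N : A -> nat) :
  ptime eA enc_un N -> ptime eA enc_un (fun x => scale E (N x)).
Proof. by move=> PN; do 3![apply: ptime_un_mul => //; pt]. Qed.

Lemma ptime_cap A eA (E : nat) (N : A -> nat) :
  ptime eA enc_un N -> ptime eA enc_un (fun x => cap E (N x)).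
Proof.
by move=> PN; have PK := ptime_scale E PN; do 4![apply: ptime_un_mul => //; pt].
Qed.

(** The diagonal is recognised by index and not by distance: two copies of the source are at
    distance 0 but need a positive weight. *)
Definition weight (K L : nat) (D c : rat) (i j : nat) : nat :=
  if i == j then 0 else (round K L D c).+1.

(** [lookup] reads every index beyond the given points as 0, which turns the extra vertices and the
    target into copies of the source. *)
Definition rounded (E : nat) (M : seq (seq rat)) (D : rat) : seq (seq rat) :=
  let N := nvert M in
  [seq [seq (weight (scale E N) (cap E N) D (entry M i j) i j)%:R%R
       | j <- iota 0 N.+2] | i <- iota 0 N.+2].

Lemma ptime_rounded A eA E (M : A -> seq (seq rat)) (D : A -> rat) :
  ptime eA enc_mat M -> ptime eA enc_rat D ->
  ptime eA enc_mat (fun x => rounded E (M x) (D x)).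
Proof.
move=> PM PD; have PN := ptime_nvert PM.
have PI := ptime_iota (ptime_un_succ (ptime_un_succ PN)).
apply: ptime_map (PI); apply: ptime_map; last by apply: (ptime_comp PI); pt.
apply: ptime_rat_of_nat; apply: ptime_if; [by apply: ptime_eqn; pt | by pt |].
apply: ptime_succ; have PN' : ptime (enc_pair (enc_pair eA enc_nat) enc_nat)
    enc_un (fun x => nvert (M x.1.1)) by apply: (ptime_comp PN); pt.
apply: ptime_round.
- exact: ptime_scale.
- exact: ptime_cap.
- by apply: (ptime_comp PD); pt.
- by apply: ptime_entry; pt; apply: (ptime_comp PM); pt.
Qed.

(** * Selecting a guess *)

Definition edges_le (K L : nat) (M : seq (seq rat)) (D : rat) (P : seq nat) : bool :=
  path (fun u v => ~~ ratio_lt L K D (entry M u v)) 0 P.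

Lemma ptime_edges_le A eA (K L : A -> nat) M D P :
  ptime eA enc_un K -> ptime eA enc_un L -> ptime eA enc_mat M ->
  ptime eA enc_rat D -> ptime eA (enc_list enc_nat) P ->
  ptime eA enc_bit (fun x => edges_le (K x) (L x) (M x) (D x) (P x)).
Proof.
move=> /ptime_nat_of_un PK /ptime_nat_of_un PL PM PD PP.
pose h x (st : nat * bool) v :=
  (v, st.2 && ~~ ratio_lt (L x) (K x) (D x) (entry (M x) st.1 v)).
apply: (@ptime_ext _ _ _ _ enc_bit _ (fun x => (foldl (h x) (0, true) (P x)).2)).
  move=> x; congr enc_bit; rewrite /edges_le.
  suff H u b p : (foldl (h x) (u, b) p).2 =
      b && path (fun u v => ~~ ratio_lt (L x) (K x) (D x) (entry (M x) u v)) u p.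
    exact: H.
  by elim: p u b => [|v p IH] u b /=; rewrite ?andbT // IH /= andbA.
apply: ptime_snd.
apply: (@ptime_foldl_add _ _ _ _ (enc_pair enc_nat enc_bit) enc_nat P (fun=> (0, true)) h
  (fun n => n + 10)) => //.
- by poly.
- by pt.
- rewrite /h; pt; apply: ptime_ratio_lt.
  + by apply: (ptime_comp PL); pt.
  + by apply: (ptime_comp PK); pt.
  + by apply: (ptime_comp PD); pt.
  + by apply: ptime_entry; pt; apply: (ptime_comp PM); pt.
- by move=> x [u b] v; rewrite /h /enc_pair /=; case: (_ && _); case: b => /=; lia.
Qed.

Definition least (s : seq rat) : rat :=
  foldl (fun d e => if ratio_lt 1 1 e d then e else d) (head 0%R s) s.

Lemma ptime_least A eA (f : A -> seq rat) :
  ptime eA (enc_list enc_rat) f -> ptime eA enc_rat (fun x => least (f x)).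
Proof.
move=> Pf; apply: (@ptime_foldl_add _ _ _ _ enc_rat enc_rat f (fun x => head 0%R (f x))
  (fun _ d e => if ratio_lt 1 1 e d then e else d) (fun n => n)) => //.
- by poly.
- by pt.
- by pt; apply: ptime_ratio_lt; pt.
- by move=> x s b; case: ifP => _; lia.
Qed.

(** Nonnegativity enters because [ratio_lt 1 1] compares absolute values. *)
Lemma leastP (s : seq rat) : (forall d, d \in s -> 0 <= d)%R ->
  forall e, e \in s -> least s \in s /\ (least s <= e)%R.
Proof.
have ltE (x y : rat) : (0 <= x)%R -> (0 <= y)%R -> ratio_lt 1 1 x y = (x < y)%R.
  by move=> x0 y0; rewrite /ratio_lt !mul1r !ger0_norm.
move=> s0 e es; rewrite /least.
have hs : head 0%R s \in s by case: (s) es => // a l; rewrite mem_head.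
have {es} : e = head 0%R s \/ e \in s by right.
suff H l d : {subset l <= s} -> d \in s ->
   foldl (fun d e => if ratio_lt 1 1 e d then e else d) d l \in s /\
   (forall e, e = d \/ e \in l ->
     foldl (fun d e => if ratio_lt 1 1 e d then e else d) d l <= e)%R.
  by move=> He; have [? H2] := H s _ (fun x => id) hs; split=> //; apply: H2.
elim: l d => [|b l IH] d sub ds /=; first by split=> // ? [->|//].
have bs : b \in s by apply: sub; rewrite mem_head.
have [||ms H2] := IH (if ratio_lt 1 1 b d then b else d).
- by move=> x xl; apply: sub; rewrite inE xl orbT.
- by case: ifP.
split=> // x Hx.
have Hb : (foldl (fun d e => if ratio_lt 1 1 e d then e else d)
   (if ratio_lt 1 1 b d then b else d) l <= Num.min b d)%R.
  apply: le_trans (H2 _ (or_introl erefl)) _.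
  by rewrite ltE ?s0 // /Num.min; case: ifP.
case: Hx => [->|]; first by apply: le_trans Hb _; rewrite ge_min lexx orbT.
rewrite inE => /orP[/eqP->|xl]; last by apply: H2; right.
by apply: le_trans Hb _; rewrite ge_min lexx.
Qed.

Local Open Scope ring_scope.

(** * Rounding keeps the triangle inequality *)

Lemma ratio_ltP i K (D c : rat) : 0 <= D -> 0 <= c ->
  ratio_lt i K D c = (i%:R * D < K%:R * c).
Proof. by move=> D0 c0; rewrite /ratio_lt !ger0_norm. Qed.

Lemma round_spec K L D c : [/\ (round K L D c <= L)%N,
  forall j, (j < round K L D c)%N -> ratio_lt j K D c
  & (round K L D c < L)%N -> ~~ ratio_lt (round K L D c) K D c].
Proof.
rewrite /round; elim: L => // L [le lt nlt]; rewrite iterS.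
case: ifP => [rl|/negbT rl]; split=> //.
- move=> j; rewrite ltnS leq_eqVlt => /orP[/eqP->//|]; exact: lt.
- by rewrite ltnS => /nlt; rewrite rl.
- exact: leqW.
Qed.

Lemma round_min K L D c i : ~~ ratio_lt i K D c -> (round K L D c <= i)%N.
Proof. by apply: contraNleq; case: (round_spec K L D c) => _ H _; apply: H. Qed.

Lemma round_ge K L D c : 0 <= D -> 0 <= c -> (round K L D c < L)%N ->
  K%:R * c <= (round K L D c)%:R * D.
Proof.
move=> D0 c0 lt; case: (round_spec K L D c) => _ _ /(_ lt).
by rewrite ratio_ltP // -leNgt.
Qed.

Lemma round_le_scale K L D c : 0 <= D -> 0 <= c -> D * (round K L D c)%:R <= K%:R * c + D.
Proof.
move=> D0 c0; case: (round_spec K L D c) => _ lt _.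
case: (round K L D c) lt => [|r] lt.
  by rewrite mulr0 addr_ge0 // mulr_ge0.
move: (lt r (ltnSn r)); rewrite ratio_ltP // => /ltW le.
by rewrite -natr1 mulrDr mulr1 lerD2r mulrC.
Qed.

(** If one summand sits at the cap, it already dominates. Otherwise both round upwards, so their sum
    is a point where the count for [c] must have stopped. *)
Lemma roundD K L D c c1 c2 : 0 <= D -> 0 <= c -> 0 <= c1 -> 0 <= c2 ->
  c <= c1 + c2 -> (round K L D c <= round K L D c1 + round K L D c2)%N.
Proof.
move=> D0 c0 c10 c20 le_c; have [le _ _] := round_spec K L D c.
have [ge1|lt1] := leqP L (round K L D c1).
  by apply: leq_trans le (leq_trans ge1 (leq_addr _ _)).
have [ge2|lt2] := leqP L (round K L D c2).
  by apply: leq_trans le (leq_trans ge2 (leq_addl _ _)).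
apply: round_min; rewrite ratio_ltP // -leNgt natrD mulrDl.
apply: le_trans (lerD (round_ge D0 c10 lt1) (round_ge D0 c20 lt2)).
by rewrite -mulrDr ler_wpM2l.
Qed.

Lemma weight_metric (X : Type) (f : X -> nat) (c : X -> X -> rat) K L D :
  injective f -> asym_metric c ->
  asym_metric (fun u v => (weight K L D (c u v) (f u) (f v))%:R).
Proof.
(* [D] may have any sign here: the rounded instance has to exist for every rational. *)
have roundN c' : round K L D c' = round K L `|D| c'.
  by rewrite /round /ratio_lt normr_id.
move=> f_inj [c0 cuu ctri]; split=> [u v|u|u v w]; rewrite ?ler0n //.
  by rewrite /weight eqxx.
rewrite -natrD ler_nat /weight.
have [_|/eqP uw] := eqVneq (f u) (f w); first by [].
have [/f_inj eu|_] := eqVneq (f u) (f v); first by subst u; case: eqP uw.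
have [/f_inj<-|_] := eqVneq (f v) (f w); first by rewrite addn0.
have := @roundD K L `|D| _ _ _ (normr_ge0 D) (c0 u w) (c0 u v) (c0 v w) (ctri u v w).
by rewrite !roundN; lia.
Qed.

(** * Latency along a list *)

(** Latency counted by edges: the edge into [y] delays [y] and every later vertex, hence the factor
    [size r]. *)
Fixpoint lat (T : Type) (c : T -> T -> rat) (x : T) (r : seq T) : rat :=
  if r is y :: r' then (size r)%:R * c x y + lat c y r' else 0.

Lemma lat_map T U (f : T -> U) (c : U -> U -> rat) x r :
  lat c (f x) (map f r) = lat (fun u v => c (f u) (f v)) x r.
Proof. by elim: r x => //= y r IH x; rewrite IH size_map. Qed.

Lemma lat_ge0 T (c : T -> T -> rat) x r : (forall u v, 0 <= c u v) -> 0 <= lat c x r.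
Proof. by move=> c0; elim: r x => //= y r IH x; rewrite addr_ge0 ?mulr_ge0. Qed.

(** Shortcutting: by the triangle inequality no remaining vertex is reached later, and fewer
    vertices are counted. [start] covers a dropped first vertex, by a detour through it. *)
Lemma lat_filter T (c : T -> T -> rat) a x r : asym_metric c ->
  lat c x (filter a r) <= lat c x r.
Proof.
move=> [c0 _ ctri].
have start x' y s : lat c x' s <= (size s)%:R * c x' y + lat c y s.
  case: s => [|z s] /=; first by rewrite mul0r addr0.
  by rewrite addrA lerD2r -mulrDr ler_wpM2l.
elim: r x => //= y r IH x; case: ifP => _ /=.
  apply: lerD (IH y); apply: ler_wpM2r => //.
  by rewrite ler_nat ltnS size_filter count_size.
apply: le_trans (start x y _) _; apply: lerD (IH y); apply: ler_wpM2r => //.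
by rewrite ler_nat size_filter leqW ?count_size.
Qed.

(** With [m = size r] the edge multiplicities sum to [m (m + 1) / 2 <= m^2], so an additive error
    [e] per edge costs at most [e m^2]. *)
Lemma lat_affine T (c c' : T -> T -> rat) (a b e : rat) x r : 0 <= e ->
  path (fun u v => a * c u v <= b * c' u v + e) x r ->
  a * lat c x r <= b * lat c' x r + e * (size r)%:R ^+ 2.
Proof.
move=> e0; elim: r x => [|y r IH] x /=; first by rewrite !mulr0 addr0.
move=> /andP[le_xy /IH{}IH]; rewrite -natr1; set m := (size r)%:R in IH *.
have m0 : 0 <= m by rewrite ler0n.
have := ler_wpM2l (addr_ge0 m0 ler01) le_xy; nra.
Qed.

Lemma lat_edge T (c : T -> T -> rat) x r B : (forall u v, 0 <= c u v) ->
  lat c x r <= B -> path (fun u v => c u v <= B) x r.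
Proof.
move=> c0; elim: r x => //= y r IH x le_B.
have l0 := lat_ge0 y r c0; have xy0 := c0 x y.
have le_xy : c x y <= (size r).+1%:R * c x y by rewrite ler_peMl // ler1n.
by apply/andP; split; [|apply: IH]; lra.
Qed.

Lemma dist_along_cat (X : finType) (c : X -> X -> rat) s t v : v \in s ->
  dist_along c (s ++ t) v = dist_along c s v.
Proof.
move=> vs; rewrite /dist_along index_cat vs take_cat.
case: ltnP => // le; have lt : (index v s < size s)%N by rewrite index_mem.
have -> : (index v s).+1 = size s by apply/eqP; rewrite eqn_leq lt le.
by rewrite subnn take0 cats0 take_size.
Qed.

Lemma lat_dist (X : finType) (c : X -> X -> rat) x r : uniq (x :: r) ->
  \sum_(v <- r) dist_along c (x :: r) v = lat c x r.
Proof.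
have d0 y s : dist_along c (y :: s) y = 0.
  by rewrite /dist_along /= eqxx take0 /path_length big_nil.
elim: r x => [|y r IH] x; first by rewrite big_nil.
move=> /andP[xr yr] /=; rewrite -(IH y yr).
have -> : \sum_(v <- y :: r) dist_along c (x :: y :: r) v =
    \sum_(v <- y :: r) (c x y + dist_along c (y :: r) v).
  apply: eq_big_seq => v vr; rewrite /dist_along.
  have -> : index v (x :: y :: r) = (index v (y :: r)).+1.
    by rewrite /=; case: eqP => // exv; move: xr; rewrite exv vr.
  by rewrite /path_length /= big_cons.
rewrite big_split /= [X in _ + X]big_cons d0 add0r; congr (_ + _).
by rewrite big_const_seq count_predT iter_addr_0 mulr_natl.
Qed.

Lemma latency_dl (n : nat) (c : 'I_n.+1 -> 'I_n.+1 -> rat) r :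
  spanning_path_from ord0 (ord0 :: r) ->
  latency c [set~ ord0] (ord0 :: r) = lat c ord0 r.
Proof.
move=> [_ un all_r]; rewrite -lat_dist //; move: (un) => /andP[r0 ur].
rewrite /latency [RHS](big_uniq _ ur) /=; apply: eq_bigl => v.
rewrite !inE; have := all_r v; rewrite inE.
by case: eqP => [->|_ /= -> //]; rewrite (negbTE r0).
Qed.

Lemma latency_dlt (n : nat) (c : 'I_n.+2 -> 'I_n.+2 -> rat) r :
  spanning_path_from ord0 (ord0 :: rcons r ord_max) ->
  latency c (~: [set ord0; ord_max]) (ord0 :: rcons r ord_max) = lat c ord0 r.
Proof.
move=> [_]; rewrite -rcons_cons => un all_r; move: (un).
rewrite rcons_uniq => /andP[nr un']; rewrite -lat_dist //.
move: (un') => /andP[r0 ur]; rewrite /latency.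
rewrite [RHS](big_uniq _ ur) /=.
have rE v : (v \in ~: [set ord0; ord_max]) = (v \in r).
  rewrite !inE negb_or; have := all_r v; rewrite mem_rcons !inE.
  case: (v =P ord0) => [->|_] /=; first by rewrite (negbTE r0).
  case: eqP => [-> _|_ /= -> //]; apply/esym/negbTE.
  by apply: contra nr; rewrite inE => ->; rewrite orbT.
rewrite (eq_bigl _ _ rE); apply: eq_bigr => v vr.
by rewrite -rcons_cons -cats1 dist_along_cat // inE vr orbT.
Qed.

(** * The reduction *)

Definition table (N : nat) (c : 'I_N -> 'I_N -> rat) : seq (seq rat) :=
  [seq [seq c u v | v <- enum 'I_N] | u <- enum 'I_N].

Lemma enc_matrixE N (c : 'I_N -> 'I_N -> rat) : enc_matrix c = enc_mat (table c).
Proof.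
rewrite /enc_matrix /enc_list /table -map_comp; congr enc_seq.
by apply: eq_map => u /=; rewrite -map_comp.
Qed.

Lemma lookup_enum T x0 n (f : 'I_n.+1 -> T) i :
  lookup x0 [seq f u | u <- enum 'I_n.+1] i = f (inord i).
Proof.
rewrite /lookup; have [lt_in|le_ni] := ltnP i n.+1.
  rewrite (nth_map ord0) ?size_enum_ord //; congr f; apply: val_inj.
  by rewrite /= nth_enum_ord // inordK.
rewrite nth_default; last by rewrite size_map size_enum_ord.
rewrite enum_ordSl /=; congr f.
by rewrite /inord /insubd insubN // -leqNgt.
Qed.

Definition dl_table (I : dl_instance) : seq (seq rat) := table (@dl_c I).

Lemma entry_table (I : dl_instance) i j :
  entry (dl_table I) i j = dl_c (inord i : 'I_(dl_n I).+1) (inord j).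
Proof. by rewrite /entry /dl_table /table !lookup_enum. Qed.

Lemma size_dl_table I : size (dl_table I) = (dl_n I).+1.
Proof. by rewrite size_map size_enum_ord. Qed.

Definition nv (I : dl_instance) : nat := nvert (dl_table I).

Lemma nv_ge I : (dl_n I + 10 <= nv I)%N.
Proof. by apply: leq_trans (leq_pad _); rewrite size_dl_table; lia. Qed.

(** Taken on numbers instead of ordinals: paths of both instances then have the same type, and
    dropping the copies is a plain [filter]. *)
Definition rdist (E : nat) (I : dl_instance) (D : rat) (i j : nat) : rat :=
  (weight (scale E (nv I)) (cap E (nv I)) D (entry (dl_table I) i j) i j)%:R.

Lemma rdist_metric (X : Type) (f : X -> nat) E I D : injective f ->
  asym_metric (fun u v => rdist E I D (f u) (f v)).
Proof.
move=> f_inj; rewrite /rdist; have [c0 cuu ctri] := dl_metric I.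
apply: (weight_metric (c := fun u v => entry (dl_table I) (f u) (f v))) => //.
by split=> *; rewrite !entry_table.
Qed.

Definition rinst (E : nat) (I : dl_instance) (D : rat) : dlt_instance :=
  DLTInstance (rdist_metric E I D (@ord_inj (nv I).+2)).

Lemma enc_rinst E I D :
  enc_matrix (@dlt_c (rinst E I D)) = enc_mat (rounded E (dl_table I) D).
Proof.
rewrite enc_matrixE; congr enc_list; rewrite /rounded -/(nv I) -val_enum_ord.
rewrite /table -map_comp; apply: eq_map => u /=.
by rewrite -map_comp.
Qed.

(** Weights are at most [L + 1 = 4 N^4 E^2 + 1]. As [E <= 2/eps] and [eps <= 1], this is at most
    [17 N^4 / eps^2], which is below [2 N^5 / eps^2] because [N >= 10]. *)
Lemma nice_rinst (R : realType) (eps : R) E I D : 0 < eps <= 1 ->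
  E%:R <= 2 / eps -> nice eps (rinst E I D).
Proof.
move=> /andP[e0 e1] leE; split; first exact: pad_pow2.
move=> u v uv; rewrite /= /rdist /weight; case: eqP => [/val_inj/eqP|_].
  by rewrite (negbTE uv).
split; [exact: natr_int | by rewrite ltr0n | rewrite ratr_nat].
have [le _ _] := round_spec (scale E (nv I)) (cap E (nv I)) D (entry (dl_table I) u v).
apply: (@le_trans _ _ (cap E (nv I)).+1%:R); first by rewrite ler_nat.
have := nv_ge I; set N := nv I => leN.
have -> : (cap E N).+1%:R = 4 * N%:R ^+ 4 * E%:R ^+ 2 + 1 :> R.
  by rewrite -natr1 /cap /scale !natrM; ring.
have N10 : 10 <= N%:R :> R by rewrite ler_nat; lia.
have E2 : E%:R ^+ 2 <= 4 / eps ^+ 2 :> R.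
  have -> : 4 / eps ^+ 2 = (2 / eps) ^+ 2 by field; rewrite gt_eqF.
  by rewrite ler_sqr ?nnegrE // divr_ge0 // ltW.
have i1 : 1 <= 1 / eps ^+ 2 by rewrite ler_pdivlMr ?exprn_gt0 // mul1r expr_le1 // ltW.
have N4 : 1 <= N%:R ^+ 4 :> R by rewrite exprn_ege1 //; lra.
set x := N%:R ^+ 4 in N4 *; set y := 1 / eps ^+ 2 in i1.
have -> : 2 * N%:R ^+ 5 / eps ^+ 2 = 2 * N%:R * x * y :> R.
  by rewrite /x /y; field; rewrite gt_eqF.
have E2' : E%:R ^+ 2 <= 4 * y by rewrite /y mulrA mulr1.
have x0 : 0 <= x by lra.
have H1 := ler_wpM2l x0 E2'.
have H2 : 1 <= x * y by rewrite -[1]mulr1 ler_pM.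
have H3 : 10 * (x * y) <= N%:R * (x * y) by rewrite ler_wpM2r //; lra.
by lra.
Qed.

(** * Feasible solutions as lists of numbers *)

Lemma spanning_map_inord n (s : seq nat) : uniq s -> (forall i, (i \in s) = (i < n.+1)%N) ->
  forall x s', s = x :: s' -> spanning_path_from (inord x : 'I_n.+1) (map inord s).
Proof.
move=> us ms x s' es; split; first by rewrite es.
  rewrite map_inj_in_uniq // => i j; rewrite !ms => lti ltj /(congr1 val) /=.
  by rewrite !inordK.
by move=> v; apply/mapP; exists (val v); rewrite ?ms ?ltn_ord ?inord_val.
Qed.

Lemma spanning_cons n (x : 'I_n.+1) P : spanning_path_from x P ->
  exists2 r, P = x :: r & uniq (map val P) /\ forall i, (i \in map val P) = (i < n.+1)%N.
Proof.
case: P => [[]//|y r] [[->] un all_P]; exists r => //; split.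
  by rewrite (map_inj_uniq val_inj).
move=> i; apply/mapP/idP => [[v _ ->]|lt_i]; first exact: ltn_ord.
by exists (Ordinal lt_i).
Qed.

Lemma dl_feasible_lat I (P : seq 'I_(dl_n I).+1) : spanning_path_from ord0 P ->
  exists q, [/\ map val P = 0%N :: q, uniq (0%N :: q),
    forall i, (i \in 0%N :: q) = (i < (dl_n I).+1)%N
    & latency (@dl_c I) (dl_V I) P = lat (entry (dl_table I)) 0 q].
Proof.
move=> sp; have [r eP [un mem]] := spanning_cons sp.
rewrite eP in sp un mem *; exists (map val r); split=> //.
rewrite latency_dl //; have -> : lat (entry (dl_table I)) 0 (map val r) =
   lat (fun u v : 'I_(dl_n I).+1 => entry (dl_table I) u v) ord0 r.
  by rewrite -lat_map.
have lat_ext T (c c' : T -> T -> rat) x s : c =2 c' -> lat c x s = lat c' x s.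
  by move=> e; elim: s x => //= y s IH x; rewrite e IH.
by apply: lat_ext => u v; rewrite entry_table !inord_val.
Qed.

Lemma dlt_feasible_lat E I D (P : seq 'I_(nv I).+2) :
  spanning_path_from ord0 P -> last ord0 P = ord_max ->
  exists r, [/\ map val P = 0%N :: rcons r (nv I).+1,
    uniq (0%N :: rcons r (nv I).+1),
    forall i, (i \in 0%N :: rcons r (nv I).+1) = (i < (nv I).+2)%N
    & latency (@dlt_c (rinst E I D)) (dlt_V (rinst E I D)) P =
      lat (rdist E I D) 0 r].
Proof.
move=> sp; have [r eP [un mem]] := spanning_cons sp.
rewrite eP in sp un mem *; case/lastP: r eP sp un mem => [|r y] eP sp un mem.
  by move=> /= /(congr1 val).
rewrite /= last_rcons => ey; rewrite {}ey in sp un mem *.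
exists (map val r); move: un mem; rewrite /= map_rcons /= => un mem; split=> //.
by rewrite [LHS]latency_dlt // -(lat_map val).
Qed.

(** The interval is [n + 1, ..., N]: all copies of the source except [N + 1], which serves as
    target. *)
Definition padded (I : dl_instance) (q : seq nat) : seq nat :=
  iota (dl_n I).+1 (nv I - dl_n I) ++ q.

Lemma size_padded I q : size q = dl_n I -> size (padded I q) = nv I.
Proof. by move=> szq; have := nv_ge I; rewrite size_cat size_iota szq; lia. Qed.

Lemma entry_ge0 I i j : 0 <= entry (dl_table I) i j.
Proof. by rewrite entry_table; case: (dl_metric I). Qed.

Lemma entry_diag I i : entry (dl_table I) i i = 0.
Proof. by rewrite entry_table; case: (dl_metric I). Qed.

Lemma entry_dummy I y : (dl_n I < y)%N ->
  (forall j, entry (dl_table I) y j = entry (dl_table I) 0 j) /\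
  (forall i, entry (dl_table I) i y = entry (dl_table I) i 0).
Proof.
move=> lt_y; have y0 : inord y = ord0 :> 'I_(dl_n I).+1.
  by rewrite /inord /insubd insubN // -leqNgt.
have z0 : inord 0 = ord0 :> 'I_(dl_n I).+1 by apply: val_inj; rewrite /= inordK.
by split=> j; rewrite !entry_table y0 z0.
Qed.

(* Copies of the source can be prepended for free. *)
Lemma padded_ind (I : dl_instance) (P : nat -> seq nat -> Prop) q :
  (forall x, (forall j, entry (dl_table I) x j = entry (dl_table I) 0 j) -> P x q) ->
  (forall x y s, entry (dl_table I) x y = 0 -> P y s -> P x (y :: s)) ->
  P 0%N (padded I q).
Proof.
move=> Pq Pcons; rewrite /padded.
have : all (fun y => (dl_n I < y)%N) (iota (dl_n I).+1 (nv I - dl_n I)).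
  by apply/allP => y; rewrite mem_iota => /andP[].
have : forall j, entry (dl_table I) 0 j = entry (dl_table I) 0 j by [].
elim: (iota _ _) {1 3}0%N => [|y s IH] x ex /=; first by move=> _; apply: Pq.
case/andP=> /entry_dummy[ey1 ey2] /IH{}IH; apply: Pcons; last exact: IH.
by rewrite ey2 ex entry_diag.
Qed.

Lemma lat_padded I q :
  lat (entry (dl_table I)) 0 (padded I q) = lat (entry (dl_table I)) 0 q.
Proof.
apply: (padded_ind (P := fun x s => lat _ x s = _)) => [x ex|x y s exy IH].
  by case: q => //= y q; rewrite ex.
by rewrite /= exy mulr0 add0r.
Qed.

Lemma path_padded I D q : 0 <= D ->
  path (fun u v => entry (dl_table I) u v <= D) 0 q ->
  path (fun u v => entry (dl_table I) u v <= D) 0 (padded I q).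
Proof.
move=> D0 pq.
apply: (padded_ind (P := fun x s => is_true (path _ x s))) => [x ex|x y s exy IH] /=.
  by case: q pq => //= y q; rewrite ex.
by rewrite exy D0.
Qed.

(** * Comparing rounded and original lengths *)

Lemma path_all T (e : rel T) x s : (forall u v, e u v) -> path e x s.
Proof. by move=> He; elim: s x => //= y s IH x; rewrite He IH. Qed.

(** One [D] is lost to the ceiling, the other to the [.+1] in [weight]. *)
Lemma rdist_le_entry E I D u v : 0 <= D ->
  D * rdist E I D u v <= (scale E (nv I))%:R * entry (dl_table I) u v + 2 * D.
Proof.
move=> D0; rewrite /rdist /weight; case: eqP => _.
  by rewrite mulr0 addr_ge0 ?mulr_ge0 ?entry_ge0.
have := round_le_scale (scale E (nv I)) (cap E (nv I)) D0 (entry_ge0 I u v).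
by rewrite -natr1 mulrDr mulr1; lra.
Qed.

Lemma rdist_le_scale E I D u v : 0 <= D -> entry (dl_table I) u v <= D ->
  rdist E I D u v <= (scale E (nv I))%:R + 1.
Proof.
move=> D0 le_D; rewrite /rdist /weight natr1 ler_nat; case: eqP => _ //.
rewrite ltnS; apply: round_min; rewrite ratio_ltP ?entry_ge0 // -leNgt.
by rewrite ler_wpM2l.
Qed.

(** Below the cap, rounding upwards gives the inequality; at the cap, the hypothesis supplies it. *)
Lemma entry_le_rdist E I D u v : 0 <= D ->
  ~~ ratio_lt (cap E (nv I)) (scale E (nv I)) D (entry (dl_table I) u v) ->
  (scale E (nv I))%:R * entry (dl_table I) u v <= D * rdist E I D u v.
Proof.
move=> D0 nlt; rewrite /rdist /weight; case: eqP => [->|_].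
  by rewrite entry_diag !mulr0.
set K := scale _ _ in nlt *; set L := cap _ _ in nlt *.
have [le _ _] := round_spec K L D (entry (dl_table I) u v).
rewrite -natr1 mulrDr mulr1; apply: ler_wpDr => //.
move: le; rewrite leq_eqVlt => /orP[/eqP->|lt].
  by move: nlt; rewrite ratio_ltP ?entry_ge0 // -leNgt mulrC [D * _]mulrC mulrC.
by rewrite [D * _]mulrC round_ge ?entry_ge0.
Qed.

Lemma good_guess (R : realType) (alpha : R) E I D q r :
  0 <= D -> (0 < E)%N -> 0 <= alpha <= E%:R -> size q = dl_n I ->
  path (fun u v => entry (dl_table I) u v <= D) 0 q ->
  ratr (lat (rdist E I D) 0 r) <= alpha * ratr (lat (rdist E I D) 0 (padded I q)) ->
  edges_le (scale E (nv I)) (cap E (nv I)) (dl_table I) D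
    [seq v <- r | (v < (dl_n I).+1)%N].
Proof.
move=> D0 E0 /andP[a0 aE] szq pq le_r; have leN := nv_ge I.
set K := scale E (nv I); set N := nv I in leN *; set L := cap E N.
have met := rdist_metric E I D (@inj_id nat).
have le_t : lat (rdist E I D) 0 (padded I q) <= (K%:R + 1) * N%:R ^+ 2.
  (* The goal is brought into the form of [lat_affine] with [a = 1], [b = 0] and [e = K + 1]. *)
  rewrite -[N](size_padded szq) -[lat _ _ _]mul1r -[leRHS]add0r.
  rewrite -[X in _ <= X + _](mul0r (lat (rdist E I D) 0 (padded I q))).
  apply: lat_affine; first by rewrite addr_ge0 // ler0n.
  apply: sub_path (path_padded D0 pq) => u v /(rdist_le_scale E D0).
  by rewrite mul1r mul0r add0r.
have le_L : lat (rdist E I D) 0 r <= L%:R.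
  rewrite -(ler_rat R) ratr_nat; apply: le_trans le_r _.
  have K1 : 1 <= K%:R :> R by rewrite ler1n /K /scale !muln_gt0 E0; lia.
  have -> : L%:R = E%:R * (2 * K%:R * N%:R ^+ 2) :> R.
    by rewrite /L /cap -/K !natrM; ring.
  apply: ler_pM => //; first by rewrite ler0q lat_ge0 //; case: met.
  apply: le_trans (_ : ratr ((K%:R + 1) * N%:R ^+ 2) <= _); first by rewrite ler_rat.
  rewrite rmorphM rmorphXn rmorphD /= !ratr_nat rmorph1.
  by apply: ler_wpM2r; [exact: sqr_ge0 | lra].
have {le_L} le_p := le_trans (lat_filter (fun v => (v < (dl_n I).+1)%N) 0%N r met) le_L.
have := lat_edge (let: And3 H _ _ := met in H) le_p.
(* The [.+1] in [weight] turns a weight of at most [L] into a rounded value strictly below the cap,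
   where [round_ge] applies. *)
apply: sub_path => u v; rewrite /rdist /weight ler_nat -/N -/K -/L.
case: eqP => [->|_] lt; rewrite ratio_ltP ?entry_ge0 // -leNgt.
  by rewrite entry_diag mulr0 mulr_ge0.
apply: le_trans (round_ge D0 (entry_ge0 _ _ _) lt) _.
by rewrite ler_wpM2r // ler_nat ltnW.
Qed.

(** The rounding loss is proportional to [D], and [D <= lat ... q] is the only link between [D] and
    [q]. The smallest passing guess can therefore be measured against every [q]. *)
Lemma guess_cost (R : realType) (alpha eps : R) E I D q r :
  0 <= D -> (0 < E)%N -> 0 <= alpha -> 0 < eps -> 1 / eps <= E%:R -> size q = dl_n I ->
  D <= lat (entry (dl_table I)) 0 q ->
  edges_le (scale E (nv I)) (cap E (nv I)) (dl_table I) D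
    [seq v <- r | (v < (dl_n I).+1)%N] ->
  ratr (lat (rdist E I D) 0 r) <= alpha * ratr (lat (rdist E I D) 0 (padded I q)) ->
  ratr (lat (entry (dl_table I)) 0 [seq v <- r | (v < (dl_n I).+1)%N]) <=
    alpha * (1 + eps) * ratr (lat (entry (dl_table I)) 0 q).
Proof.
move=> D0 E0 a0 e0 eE szq leD good le_r; have leN := nv_ge I.
set p := filter _ r in good *.
set K := scale E (nv I) in good; set N := nv I in leN K good *; set L := cap E N in good.
set X := lat _ 0 q in leD *.
have met := rdist_metric E I D (@inj_id nat).
have H1 : K%:R * lat (entry (dl_table I)) 0 p <= D * lat (rdist E I D) 0 r.
  apply: le_trans (_ : D * lat (rdist E I D) 0 p <= _); last first.
    by apply: ler_wpM2l => //; apply: lat_filter.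
  have := @lat_affine _ (entry (dl_table I)) (rdist E I D) K%:R D 0 0%N p (lexx _).
  rewrite mul0r addr0; apply; apply: sub_path good => u v.
  by rewrite addr0; apply: entry_le_rdist.
have H2 : D * lat (rdist E I D) 0 (padded I q) <= K%:R * X + 2 * X * N%:R ^+ 2.
  apply: le_trans (_ : _ <= K%:R * X + 2 * D * N%:R ^+ 2) _; last first.
    by rewrite lerD2l ler_wpM2r ?sqr_ge0 // ler_wpM2l.
  rewrite /X -(lat_padded I q) -[N](size_padded szq); apply: lat_affine.
    by rewrite mulr_ge0.
  by apply: path_all => u v; apply: rdist_le_entry.
have K0 : 0 < K%:R :> R by rewrite ltr0n /K /scale !muln_gt0 E0; lia.
rewrite -(ler_pM2l K0).
have H1R : K%:R * ratr (lat (entry (dl_table I)) 0 p) <=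
    ratr D * ratr (lat (rdist E I D) 0 r) :> R.
  by rewrite -(ratr_nat R K) -!rmorphM /= ler_rat.
apply: le_trans H1R _.
have D0R : 0 <= ratr D :> R by rewrite ler0q.
apply: le_trans (ler_wpM2l D0R le_r) _.
have H2R : ratr D * ratr (lat (rdist E I D) 0 (padded I q)) <=
    K%:R * ratr X + 2 * ratr X * N%:R ^+ 2 :> R.
  by move: H2; rewrite -(ler_rat R) rmorphD !rmorphM /= !ratr_nat.
have X0 : 0 <= ratr X :> R by rewrite ler0q; apply: le_trans leD.
have eE1 : 1 <= E%:R * eps by rewrite -ler_pdivrMr.
have NX : 0 <= 2 * N%:R ^+ 2 * ratr X :> R.
  by apply: mulr_ge0 => //; apply: mulr_ge0; rewrite ?ler0n ?sqr_ge0.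
have -> : K%:R * (alpha * (1 + eps) * ratr X) = alpha * (K%:R * (1 + eps) * ratr X).
  by ring.
rewrite mulrCA; apply: ler_wpM2l => //; apply: le_trans H2R _.
have -> : K%:R = 2 * N%:R ^+ 2 * E%:R :> R by rewrite /K /scale !natrM; ring.
(* [1 <= E * eps], multiplied by [2 N^2 X], bounds the rounding loss by [K * eps * X]. *)
by have := ler_wpM2l NX eE1; lra.
Qed.

Lemma entry_in I i j : entry (dl_table I) i j \in flatten (dl_table I).
Proof.
rewrite entry_table; apply/flattenP.
exists [seq dl_c (inord i) v | v <- enum 'I_(dl_n I).+1].
  by apply/mapP; exists (inord i); rewrite ?mem_enum.
by apply/mapP; exists (inord j); rewrite ?mem_enum.
Qed.

(** Each edge has multiplicity at least 1 in [lat], hence the last bound. For the empty path a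
    diagonal entry, equal to 0, is the witness. *)
Lemma longest_edge I x q : exists D, [/\ D \in flatten (dl_table I), 0 <= D,
  path (fun u v => entry (dl_table I) u v <= D) x q
  & D <= lat (entry (dl_table I)) x q].
Proof.
elim: q x => [|y q IH] x.
  by exists (entry (dl_table I) 0 0); rewrite entry_in entry_diag.
have [D [inD D0 pD leD]] := IH y; have xy0 := entry_ge0 I x y.
have le_xy : entry (dl_table I) x y <= (size q).+1%:R * entry (dl_table I) x y.
  by rewrite ler_peMl // ler1n.
have l0 := @lat_ge0 _ _ y q (entry_ge0 I).
have [le|lt] := leP (entry (dl_table I) x y) D.
  by exists D; split; rewrite //= ?le //; lra.
exists (entry (dl_table I) x y); split; rewrite ?entry_in //=; last by lra.
by rewrite lexx; apply: sub_path pD => u v /le_trans; apply; apply: ltW.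
Qed.

Lemma size_tour n q : uniq (0%N :: q) ->
  (forall i, (i \in 0%N :: q) = (i < n.+1)%N) -> size q = n.
Proof.
move=> uq mq; suff [//] : size (0%N :: q) = n.+1.
rewrite -(size_iota 0 n.+1); apply/perm_size/uniq_perm => //.
  exact: iota_uniq.
by move=> i; rewrite mq mem_iota.
Qed.

(** Supplies the competitor against which the guarantee of the given algorithm is used. *)
Lemma padded_feasible E I D q : uniq (0%N :: q) ->
  (forall i, (i \in 0%N :: q) = (i < (dl_n I).+1)%N) ->
  exists2 S : seq 'I_(nv I).+2,
    spanning_path_from ord0 S /\ last ord0 S = ord_max &
    latency (@dlt_c (rinst E I D)) (dlt_V (rinst E I D)) S =
      lat (rdist E I D) 0 (padded I q).
Proof.
move=> uq mq; have leN := nv_ge I; set t := 0%N :: rcons (padded I q) (nv I).+1.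
have mt i : (i \in t) = (i < (nv I).+2)%N.
  have := mq i; rewrite /t /padded !inE mem_rcons inE mem_cat mem_iota.
  by case: (i \in q); lia.
have ut : uniq t.
  (* [t] covers [iota 0 (nv I).+2] and has the same length, so nothing repeats. *)
  apply: (@leq_size_uniq _ (iota 0 (nv I).+2)); first exact: iota_uniq.
    by move=> i; rewrite mem_iota mt.
  by rewrite size_iota /t /= size_rcons size_padded // (size_tour uq mq).
have sp : spanning_path_from ord0 (map inord t : seq 'I_(nv I).+2).
  by have := spanning_map_inord ut mt erefl; rewrite (_ : inord 0 = ord0) //;
    apply: val_inj; rewrite /= inordK.
have la : last ord0 (map inord t : seq 'I_(nv I).+2) = ord_max.
  by rewrite /t /= map_rcons last_rcons; apply: val_inj; rewrite /= inordK.
exists (map inord t) => //; have [r [er _ _ ->]] := dlt_feasible_lat E D sp la.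
congr lat; move: er; rewrite -map_comp map_id_in => [[] /rcons_inj[]//|i].
by rewrite mt /= => lt; rewrite inordK.
Qed.

(** The integer part of [1/eps] plus 1 works: [1 <= 1/eps] pays for the added 1. *)
Lemma inv_eps_bound (R : realType) (eps : R) : 0 < eps <= 1 ->
  exists E : nat, [/\ (0 < E)%N, 1 / eps <= E%:R & E%:R <= 2 / eps].
Proof.
move=> /andP[e0 e1]; exists (Num.truncn (1 / eps)).+1; split=> //.
  exact/ltW/truncnS_gt.
have i1 : 1 <= 1 / eps by rewrite ler_pdivlMr // mul1r.
have : (Num.truncn (1 / eps))%:R <= 1 / eps by rewrite truncn_le; lra.
by rewrite -natr1 (_ : 2 / eps = 1 / eps + 1 / eps); [lra | rewrite -mulrDl].
Qed.

Theorem theorem2p2 (R : realType) (eps alpha : R)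
    (heps : 0 < eps <= 1) (halpha : 1 <= alpha <= 1 / eps) :
  has_polytime_approx (Pb := directed_latency_target) (nice eps) alpha ->
  has_polytime_approx (Pb := directed_latency) (fun=> True)
    (alpha * (1 + eps)).
Proof.
move=> [p0 [a0 [d0 Horc]]]; have [E [E0 leE1 leE2]] := inv_eps_bound heps.
have e_gt0 : 0 < eps by case/andP: heps.
have al0 : 0 <= alpha <= E%:R by case/andP: halpha => *; apply/andP; split; lra.
(* The given algorithm is promised to work only on nice instances and is described by an
   existential. Restricting to a subtype and choosing its output with [cid] yields a total function,
   to which [ptime] applies. *)
pose J := {I : dlt_instance | nice eps I}.
pose eJ (j : J) := enc_matrix (@dlt_c (sval j)).
pose sol (j : J) := sval (cid (Horc (sval j) (svalP j))).
have solP (j : J) := svalP (cid (Horc (sval j) (svalP j))).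
pose tour (j : J) := map val (sol j : seq 'I_(dlt_n (sval j)).+2).
have Ptour : ptime eJ (enc_list enc_nat) tour.
  apply: (@ptime_of_run _ _ _ _ _ p0 a0 d0) => j; have [t [ex le _ _]] := solP j.
  by exists t => //; rewrite /enc_list /tour -map_comp.
pose eI (I : dl_instance) := enc_matrix (@dl_c I).
(* The rounded instance is nice for every rational, so even useless guesses give legitimate
   queries. *)
pose inst (x : dl_instance * rat) : J :=
  exist _ (rinst E x.1 x.2) (nice_rinst x.1 x.2 heps leE2).
have PT : ptime eI enc_mat dl_table.
  by apply: ptime_ext (ptime_id eI) => I; rewrite /eI enc_matrixE.
have PT1 : ptime (enc_pair eI enc_rat) enc_mat (fun x => dl_table x.1).
  by apply: (ptime_comp PT); pt.
have Pinst : ptime (enc_pair eI enc_rat) eJ inst.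
  have PD : ptime (enc_pair eI enc_rat) enc_rat (fun x => x.2) by pt.
  by apply: ptime_ext (ptime_rounded E PT1 PD) => x; rewrite /eJ /= enc_rinst.
pose P x := [seq v <- tour (inst x) | (v < size (dl_table x.1))%N].
have PP : ptime (enc_pair eI enc_rat) (enc_list enc_nat) P.
  apply: (ptime_filter (f := fun x v => (v < size (dl_table x.1))%N)).
    apply: ptime_ltn; first by pt.
    by apply/ptime_nat_of_un/ptime_un_size/(ptime_comp PT1); pt.
  exact: (ptime_comp Ptour).
pose good x := edges_le (scale E (nv x.1)) (cap E (nv x.1)) (dl_table x.1) x.2 (P x).
have Pgood : ptime (enc_pair eI enc_rat) enc_bit good.
  apply: ptime_edges_le => //; last by pt.
    by apply/ptime_scale/ptime_nvert.
  by apply/ptime_cap/ptime_nvert.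
pose guesses I := [seq D <- flatten (dl_table I) | good (I, D)].
have Pout : ptime eI (enc_list enc_nat) (fun I => P (I, least (guesses I))).
  apply: (ptime_comp PP); apply: ptime_pair; first by pt.
  apply: ptime_least; apply: ptime_filter; last exact: ptime_flatten.
  by apply: (ptime_comp Pgood); pt.
have [p1 [a1 [d1 Hrun]]] := run_of_ptime Pout; exists p1, a1, d1 => I _ /=.
have tourP D : exists r,
  [/\ P (I, D) = 0%N :: [seq v <- r | (v < (dl_n I).+1)%N],
      uniq (P (I, D)), forall i, (i \in P (I, D)) = (i < (dl_n I).+1)%N &
      forall q, uniq (0%N :: q) -> (forall i, (i \in 0%N :: q) = (i < (dl_n I).+1)%N) ->
        ratr (lat (rdist E I D) 0 r) <=
          alpha * ratr (lat (rdist E I D) 0 (padded I q))].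
  have [t [_ _ [sp la] opt]] := solP (inst (I, D)).
  have [r [er ur mr lr]] := dlt_feasible_lat E D sp la.
  have eP : P (I, D) = [seq v <- 0%N :: rcons r (nv I).+1 | (v < (dl_n I).+1)%N].
    by rewrite /P /tour size_dl_table -er.
  have leN := nv_ge I; exists r; split.
  - rewrite eP /= filter_rcons; case: ifP => //; lia.
  - by rewrite eP filter_uniq.
  - move=> i; rewrite eP mem_filter mr andb_idr // => lt.
    by apply: leq_trans lt _; rewrite /=; lia.
  - move=> q uq mq; have [S' fS' <-] := padded_feasible E D uq mq.
    by rewrite -lr; apply: opt.
(* [P] already begins with 0, so [good] also tests the loop from 0 to 0, which always passes. *)
have goodE D r : 0 <= D -> P (I, D) = 0%N :: r ->
    good (I, D) = edges_le (scale E (nv I)) (cap E (nv I)) (dl_table I) D r.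
  move=> D0 eP; rewrite /good eP /edges_le /= entry_diag ratio_ltP // -leNgt.
  by rewrite mulr0 mulr_ge0.
have guess_ge0 D : D \in guesses I -> 0 <= D.
  rewrite mem_filter => /andP[_ /flattenP[s /mapP[u _ ->] /mapP[v _ ->]]].
  by case: (dl_metric I).
set D := least (guesses I) in Hrun *.
have [r [eP uP mP optP]] := tourP D.
have [t run_t le_t] := Hrun I.
have PK : map val (map inord (P (I, D)) : seq 'I_(dl_n I).+1) = P (I, D).
  by rewrite -map_comp map_id_in // => i; rewrite mP => lt; rewrite /= inordK.
(* Feasibility holds for any [D]; that [guesses I] is nonempty matters for the cost and is derived
   below from a competitor. *)
have sp : spanning_path_from ord0 (map inord (P (I, D)) : seq 'I_(dl_n I).+1).
  have := spanning_map_inord uP mP eP; rewrite (_ : inord 0 = ord0) //.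
  by apply: val_inj; rewrite /= inordK.
exists (map inord (P (I, D))), t; split=> //.
  by move: run_t; rewrite -/D /enc_path -[X in enc_list _ X]PK /enc_list -map_comp.
move=> Q spQ; have [q [_ uq mq ->]] := dl_feasible_lat spQ.
have [p [ep _ _ ->]] := dl_feasible_lat sp.
have {ep} -> : p = [seq v <- r | (v < (dl_n I).+1)%N].
  by move: ep; rewrite PK eP => -[].
have szq := size_tour uq mq.
(* [D'] depends on the competitor [Q], while the output does not: the bound is proved against each
   feasible [Q] separately. *)
have [D' [inD' D'0 pD' leD']] := longest_edge I 0 q.
have [r' [eP' _ _ optP']] := tourP D'.
have in_g : D' \in guesses I.
  rewrite mem_filter inD' andbT (goodE _ _ D'0 eP').
  exact: good_guess (optP' q uq mq).
have [Dg leD] := leastP guess_ge0 in_g.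
have D0 := guess_ge0 _ Dg.
apply: (guess_cost (E := E) (D := D)) => //.
- by case/andP: al0.
- exact: le_trans leD leD'.
- by rewrite -(goodE _ _ D0 eP); move: Dg; rewrite mem_filter => /andP[].
- exact: optP.
Qed.
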